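(* Let $\lambda>0$, let $X_1,X_2,\ldots$ be i.i.d. exponentially distributed with parameter $\lambda$ (mean $1/\lambda$), and let $a>1/\lambda$. For $\alpha>0$ let $$p_N(a):=\mathbb{P}\left(\mathrm{Pois}\left(N\,\overline{X}_{N^\alpha}\right)=Na\right),$$ where $N\to\infty$ through values for which $Na$ and $N^\alpha$ are integers. Then, as $N\to\infty$: (i) If $\alpha>1$, then with $k_+:=\lfloor(\alpha-1)^{-1}\rfloor$, $$p_N(a)\sim\frac{1}{\sqrt{2\pi aN}}\,e^{\xi_0N}\exp\left(\sum_{k=1}^{k_+}\xi_kN^{(1-\alpha)k+1}\right),$$ where $$\xi_0:=-a\log(\lambda a)+a-\frac1\lambda,\qquad \xi_k:=(-1)^k\left(\lambda^{-k}\left(\frac ak-\frac{1/\lambda}{k+1}\right)-a^{k+1}\left(\frac1k-\frac1{k+1}\right)\right)\quad(k\geqslant1).$$ (ii) If $\alpha<1$, then with $k_-:=\lfloor\alpha(1-\alpha)^{-1}\rfloor$, $$p_N(a)\sim\frac{1}{\sqrt{2\pi}\,a}\,N^{\frac\alpha2-1}\,e^{\zeta_0N^\alpha}\exp\left(\sum_{k=1}^{k_-}\zeta_kN^{(\alpha-1)k+\alpha}\right),$$ where $$\zeta_0:=\log(\lambda a)+1-\lambda a,\qquad \zeta_k:=(-1)^k\left(\lambda^k\left(\frac1k-\frac{a\lambda}{k+1}\right)-a^{-k}\left(\frac1k-\frac1{k+1}\right)\right)\quad(k\geqslant1).$$ (iii) If $\alpha=1$, then $$p_N(a)\sim\fr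ac{1}{\sqrt{2\pi}}\,\frac{1}{\sqrt{Na(a+1)}}\exp\left(-N\left(a\log\left(a\,\frac{1+\lambda}{1+a}\right)+\log\left(\frac1\lambda\,\frac{1+\lambda}{1+a}\right)\right)\right).$$
   Context: For a positive integer $m$, $\overline{X}_m:=\frac1m\sum_{i=1}^mX_i$. For a non-negative random variable $Y$, $\mathrm{Pois}(Y)$ denotes a mixed Poisson random variable: conditionally on $Y=y$ it has the Poisson distribution with mean $y$. The notation $f(N)\sim g(N)$ means $f(N)/g(N)\to1$ as $N\to\infty$. Empty sums are $0$. The limit in $N$ is taken along values for which $Na$ and $N^\alpha$ are positive integers. *)

(* Defs.v *)
From HB Require Import structures.
From mathcomp Require Import all_boot all_order all_algebra finmap.
From mathcomp Require Import all_classical all_reals all_analysis.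

Set Implicit Arguments.
Unset Strict Implicit.
Unset Printing Implicit Defensive.

Import Order.TTheory GRing.Theory Num.Theory.
Import numFieldNormedType.Exports.

Local Open Scope classical_set_scope.
Local Open Scope ring_scope.

Section probabilistic_notions.
Context {d : measure_display} {T : measurableType d} {R : realType}.
Variable P : probability T R.

Definition mutually_independent (I : choiceType) (X : I -> {RV P >-> R}) :=
  forall (J : {fset I}) (B : I -> set R), (forall i, measurable (B i)) ->
    P (\bigcap_(i in [set` J]) X i @^-1` B i) =
    (\prod_(i <- J) P (X i @^-1` B i))%E.

(* Laws are compared on measurable sets only: the values of a measure on other
   sets are meaningless. *)
Definition exponentially_distributed (lambda : R) (X : {RV P >-> R}) :=
  forall B : set R, measurable B ->
    distribution P X B = exponential_prob lambda B.

(* The sequence X_1, X_2, ... is indexed from 0. *)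
Definition sample_mean (X : nat -> {RV P >-> R}) (m : nat) (t : T) : R :=
  m%:R^-1 * \sum_(i < m) X i t.

(* Z is a version of Pois(Y): y |-> Pois(y) is a regular conditional law of Z
   given Y, i.e. P(Y \in B, Z \in A) = E[1_B(Y) Pois(Y)(A)]. The second argument
   of poisson_prob is ignored by its definition; poisson_prob 0 is the Dirac
   mass at 0. *)
Definition mixed_poisson (Y : T -> R) (Z : {RV P >-> nat}) :=
  forall (B : set R) (A : set nat), measurable B ->
    P (Y @^-1` B `&` Z @^-1` A) =
    (\int[P]_(t in Y @^-1` B) poisson_prob (Y t) 0%N A)%E.

(* Z N stands for Pois(N * mean of N^alpha variables). *)
Definition p_ (Z : R -> {RV P >-> nat}) (a N : R) : R :=
  fine (P [set t | (Z N t)%:R = N * a]).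

End probabilistic_notions.

Section asymptotics.
Context {R : realType}.

Definition admissible (a alpha : R) : set R :=
  [set N | (exists2 n : nat, (0 < n)%N & N * a = n%:R) /\
           (exists2 m : nat, (0 < m)%N & N `^ alpha = m%:R)].

(* f(N) ~ g(N) as N -> oo through D *)
Definition equiv_along (D : set R) (f g : R -> R) : Prop :=
  f N / g N @[N --> within D +oo] --> (1 : R).

Variables lambda a : R.

Definition xi0 : R := - a * ln (lambda * a) + a - lambda^-1.

Definition xi (k : nat) : R :=
  (-1) ^+ k * (lambda ^- k * (a / k%:R - lambda^-1 / k.+1%:R)
               - a ^+ k.+1 * (k%:R^-1 - k.+1%:R^-1)).

Definition zeta0 : R := ln (lambda * a) + 1 - lambda * a.

Definition zeta (k : nat) : R :=
  (-1) ^+ k * (lambda ^+ k * (k%:R^-1 - a * lambda / k.+1%:R)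
               - a ^- k * (k%:R^-1 - k.+1%:R^-1)).

End asymptotics.

(* Main.v *)
(* With n = N a, m = N^alpha and c = N / m, conditioning on the sum of the m
   exponentials gives the negative binomial weight
     p_N = 'C(n + m - 1, n) lambda^m c^n / (lambda + c)^(n + m).
   Stirling's formula turns this into
     ln p_N = m H(c) - (ln n + ln (1 + a c)) / 2 - ln (2 pi) / 2 + o(1),
   where H(c) = (1 + a c) (ln (1 + a c) - ln (lambda + c)) - a c ln a + ln lambda.
   For alpha = 1 one has c = 1. For alpha > 1 (resp. alpha < 1), c tends to 0
   (resp. +oo), and the exponents in (i) (resp. (ii)) are m times the Taylor
   expansion of H in c (resp. 1 / c), cut where the terms start to vanish. *)

Require Import Defs.
From HB Require Import structures.
From mathcomp Require Import all_boot all_order all_algebra finmap.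
From mathcomp Require Import all_classical all_reals all_analysis.
From mathcomp Require Import measurable_realfun ring lra.

Set Implicit Arguments.
Unset Strict Implicit.
Unset Printing Implicit Defensive.

Import Order.TTheory GRing.Theory Num.Theory.
Import numFieldNormedType.Exports.

Local Open Scope classical_set_scope.
Local Open Scope ring_scope.

(** The law of the sum of the exponentials is never computed. A Poisson weight at a sum splits, by
    the binomial theorem, into products of weights at the summands, so the variables are absorbed
    one at a time: an exponential density only shifts the rate of the weight from c to lambda + c,
    and each expectation becomes a gamma integral. The weights are taken at absolute values because
    the variables are nonnegative only almost surely. The rest is real analysis of ln p_N. The
    Stirling errors are kept exact in [stirling_log], so that only its limit is needed. Both regimes
    then share one Taylor bound, for (1 + p x)(ln (1 + p x) - ln (1 + q x)), with (p, q, x) = (a, 1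
    / lambda, c) when c is small and (1 / a, lambda, 1 / c) when c is large. *)

(** * Derivative rules and comparison of increments *)

Section derivation.
Context {R : realType}.
Implicit Types (f g : R -> R) (x : R).

Lemma is_derive1D f g x a b : is_derive x 1 f a -> is_derive x 1 g b ->
  is_derive x 1 (fun y => f y + g y) (a + b).
Proof. by move=> df dg; exact: (is_deriveD df dg). Qed.

Lemma is_derive1B f g x a b : is_derive x 1 f a -> is_derive x 1 g b ->
  is_derive x 1 (fun y => f y - g y) (a - b).
Proof. by move=> df dg; exact: (is_deriveB df dg). Qed.

Lemma is_derive1M f g x a b : is_derive x 1 f a -> is_derive x 1 g b ->
  is_derive x 1 (fun y => f y * g y) (f x * b + g x * a).
Proof. by move=> df dg; exact: (is_deriveM df dg). Qed.

Lemma is_derive1Ml f x a c : is_derive x 1 f a ->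
  is_derive x 1 (fun y => c * f y) (c * a).
Proof. by move=> df; exact: (is_deriveZ c df). Qed.

Lemma is_derive1X f n x a : is_derive x 1 f a ->
  is_derive x 1 (fun y => f y ^+ n) (n%:R * f x ^+ n.-1 * a).
Proof.
move=> df; have := is_deriveX n df.
by rewrite (_ : f ^+ n = fun y => f y ^+ n)//;
  apply/funext => y; rewrite exprfctE.
Qed.

Lemma is_derive1_sum n (h : 'I_n -> R -> R) x (dh : 'I_n -> R) :
  (forall i, is_derive x 1 (h i) (dh i)) ->
  is_derive x 1 (fun y => \sum_(i < n) h i y) (\sum_(i < n) dh i).
Proof.
move=> dhx; have := is_derive_sum dhx.
by rewrite (_ : \sum_(i < n) h i = fun y => \sum_(i < n) h i y)//;
  apply/funext => y; rewrite fct_sumE.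
Qed.

(** The mean value theorem for [g - f]. It stands in for comparing integrals, both for the Taylor
    remainders and for the Wallis integrals. *)
Lemma le_is_derive f g f' g' (a b : R) : a <= b ->
  (forall x, a <= x <= b -> is_derive x 1 f (f' x)) ->
  (forall x, a <= x <= b -> is_derive x 1 g (g' x)) ->
  (forall x, a <= x <= b -> f' x <= g' x) ->
  f b - f a <= g b - g a.
Proof.
move=> ab df dg le_fg.
have dgf x : a <= x <= b -> is_derive x 1 (fun y => g y - f y) (g' x - f' x).
  by move=> xab; apply: is_derive1B; [exact: dg|exact: df].
have [||c] := @MVT_segment R (fun y => g y - f y) (fun x => g' x - f' x) a b ab.
- move=> x; rewrite in_itv/= => /andP[ax xb].
  by apply: dgf; rewrite (ltW ax) (ltW xb).
- apply: derivable_within_continuous => x; rewrite in_itv/= => xab.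
  by apply: ex_derive; exact: dgf.
rewrite in_itv/= => /le_fg fgc e.
have : 0 <= (g' c - f' c) * (b - a) by rewrite mulr_ge0 ?subr_ge0.
rewrite -e; lra.
Qed.

End derivation.

(** * Taylor bounds for the logarithm *)

Section log_taylor.
Context {R : realType}.
Implicit Types x : R.

Definition ln1p_poly (K : nat) x : R :=
  \sum_(k < K) (-1) ^+ k * (x ^+ k.+1 / k.+1%:R).

Lemma is_derive_ln1p_poly K x :
  is_derive x 1 (ln1p_poly K) (\sum_(k < K) (- x) ^+ k).
Proof.
apply: is_derive1_sum => k; rewrite [(- x) ^+ k]exprNn.
apply: is_derive1Ml.
under eq_fun do rewrite mulrC.
apply: (is_derive_eq (is_derive1Ml _ (is_derive1X k.+1 (is_derive_id x 1)))).
by rewrite mulr1 mulrA mulVf ?mul1r// pnatr_eq0.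
Qed.

(** The signed remainder vanishes at 0 and has derivative x ^ K / (1 + x), which lies between 0 and
    x ^ K. *)
Lemma ln1p_taylor K x : 0 <= x ->
  0 <= (-1) ^+ K * (ln (1 + x) - ln1p_poly K x) <= x ^+ K.+1 / K.+1%:R.
Proof.
move=> x0.
have dF (y : R) : 0 <= y <= x ->
    is_derive y 1 (fun z => (-1) ^+ K * (ln (1 + z) - ln1p_poly K z))
                  (y ^+ K / (1 + y)).
  move=> /andP[y0 _]; have y1 : 0 < 1 + y by lra.
  have d1 : is_derive y 1 (fun z : R => 1 + z) 1.
    have := is_derive1D (is_derive_cst (1 : R) y 1) (is_derive_id y 1).
    by rewrite add0r.
  have dln := @is_derive1_comp R (@ln R) (fun z : R => 1 + z) y _ _
    (is_derive1_ln y1) d1.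
  apply: (is_derive_eq (is_derive1Ml _
    (is_derive1B dln (is_derive_ln1p_poly K y)))).
  rewrite mulr1.
  (* Geometric sum of ratio - y; its constant part cancels the derivative of the logarithm. *)
  have -> : \sum_(k < K) (- y) ^+ k = (1 - (- y) ^+ K) / (1 + y).
    apply: (mulIf (lt0r_neq0 y1)); rewrite divfK ?lt0r_neq0//.
    by rewrite -[RHS]opprB subrX1 -mulNr mulrC opprB opprK.
  rewrite /= mulrBl mul1r opprB addrCA subrr addr0 mulrA.
  by rewrite -exprMn mulN1r opprK.
have dG (y : R) : 0 <= y <= x ->
    is_derive y 1 (fun z : R => z ^+ K.+1 / K.+1%:R) (y ^+ K).
  move=> _; under eq_fun do rewrite mulrC.
  apply: (is_derive_eq (is_derive1Ml _ (is_derive1X K.+1 (is_derive_id y 1)))).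
  by rewrite mulr1 mulrA mulVf ?mul1r// pnatr_eq0.
have p0 : ln1p_poly K (0:R) = 0.
  by rewrite /ln1p_poly big1// => k _; rewrite expr0n mul0r mulr0.
have F0 : (-1) ^+ K * (ln (1 + 0) - ln1p_poly K 0) = 0 :> R.
  by rewrite addr0 ln1 p0 subrr mulr0.
apply/andP; split.
  have := @le_is_derive R (cst 0) _ (cst 0) _ 0 x x0
    (fun y _ => is_derive_cst 0 y 1) dF.
  rewrite F0 !subr0; apply => y /andP[y0 _].
  by rewrite divr_ge0 ?exprn_ge0 ?addr_ge0.
have := le_is_derive x0 dF dG; rewrite F0 expr0n mul0r !subr0; apply.
move=> y /andP[y0 _]; rewrite ler_pdivrMr; last lra.
by rewrite ler_peMr ?exprn_ge0// lerDl.
Qed.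

End log_taylor.

(** * Wallis' product and Stirling's formula *)

Section wallis.
Context {R : realType}.
Implicit Types x : R.

(* Reduction formula for the primitive of sin ^+ n vanishing at 0. *)
Fixpoint sin_primitive n x : R :=
  match n with
  | 0 => x
  | 1 => 1 - cos x
  | (m.+1 as k).+1 =>
      (k%:R * sin_primitive m x - cos x * sin x ^+ k) / k.+1%:R
  end.

Lemma is_derive_sin_primitive n x :
  is_derive x 1 (sin_primitive n) (sin x ^+ n).
Proof.
suff: is_derive x 1 (sin_primitive n) (sin x ^+ n) /\
      is_derive x 1 (sin_primitive n.+1) (sin x ^+ n.+1) by case.
elim: n => [|n [IH0 IH1]]; split=> //.
- rewrite expr0; exact: is_derive_id.
- have := is_derive1B (is_derive_cst (1 : R) x 1) (is_derive_cos x).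
  by rewrite sub0r opprK expr1.
- have -> : sin_primitive n.+2 = fun y => n.+2%:R^-1 *
      (n.+1%:R * sin_primitive n y - cos y * sin y ^+ n.+1).
    by apply/funext => y /=; rewrite mulrC.
  have d1 := is_derive1Ml n.+1%:R IH0.
  have d2 := is_derive1M (is_derive_cos x) (is_derive1X n.+1 (is_derive_sin x)).
  apply: (is_derive_eq (is_derive1Ml n.+2%:R^-1 (is_derive1B d1 d2))).
  rewrite /= (_ : cos x * (n.+1%:R * sin x ^+ n * cos x) =
                  n.+1%:R * sin x ^+ n * cos x ^+ 2); last by ring.
  have n20 : (n.+2%:R : R) != 0 by rewrite pnatr_eq0.
  by rewrite cos2sin2 !exprS; field.
Qed.

(** The Wallis integral of sin ^ n over [0, pi / 2]. *)
Definition wallis n : R := sin_primitive n (pi / 2).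

Lemma wallis0 : wallis 0 = pi / 2. Proof. by []. Qed.

Lemma wallis1 : wallis 1 = 1.
Proof. by rewrite /wallis /= cos_pihalf subr0. Qed.

Lemma wallisSS n : wallis n.+2 = n.+1%:R / n.+2%:R * wallis n.
Proof. by rewrite /wallis /= cos_pihalf mul0r subr0 mulrAC. Qed.

Lemma wallis_gt0 n : 0 < wallis n.
Proof.
suff: 0 < wallis n /\ 0 < wallis n.+1 by case.
elim: n => [|n [w0 w1]]; split=> //.
- by rewrite wallis0 divr_gt0 ?pi_gt0.
- by rewrite wallis1.
- by rewrite wallisSS mulr_gt0// divr_gt0.
Qed.

Lemma sin_primitive0 n : sin_primitive n 0 = 0 :> R.
Proof.
suff: sin_primitive n 0 = 0 :> R /\ sin_primitive n.+1 0 = 0 :> R by case.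
elim: n => [|n [w0 w1]]; split=> //=; first by rewrite cos0 subrr.
by rewrite w0 sin0 exprS !(mul0r, mulr0) subrr mul0r.
Qed.

Lemma wallis_le n : wallis n.+1 <= wallis n.
Proof.
have p0 : 0 <= (pi : R) / 2 by rewrite divr_ge0 ?pi_ge0.
have := @le_is_derive R (sin_primitive n.+1) (sin_primitive n)
  (fun y => sin y ^+ n.+1) (fun y => sin y ^+ n) 0 (pi / 2) p0
  (fun y _ => is_derive_sin_primitive n.+1 y)
  (fun y _ => is_derive_sin_primitive n y).
rewrite !sin_primitive0 !subr0; apply => y /andP[y0 yp].
have s0 : 0 <= sin y by apply: sin_ge0_pi; rewrite y0/=; have := pi_ge0 R; lra.
by rewrite exprSr ler_piMr ?exprn_ge0 ?sin_le1.
Qed.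

(** By [wallisSS] the product does not depend on n. It gives the exact value against which a squared
    Wallis integral is compared. *)
Lemma wallisM n : n.+1%:R * (wallis n.+1 * wallis n) = pi / 2.
Proof.
elim: n => [|n IH]; first by rewrite wallis1 wallis0 !mul1r.
rewrite wallisSS -IH.
have n20 : (n.+2%:R : R) != 0 by rewrite pnatr_eq0.
by field.
Qed.

(** The bridge to factorials: the second factor is the central binomial coefficient divided by 4 ^
    n. *)
Lemma wallis_even n :
  wallis n.*2 = pi / 2 * ((n.*2)`!%:R / (4 ^+ n * n`!%:R ^+ 2)).
Proof.
elim: n => [|n IH]; first by rewrite wallis0 fact0 expr0 expr1n mul1r divr1 mulr1.
rewrite doubleS wallisSS IH !factS [4 ^+ n.+1]exprS !natrM.
have f0 : (n`!%:R : R) != 0 by rewrite pnatr_eq0 -lt0n fact_gt0.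
have n0 : (n.+1%:R : R) != 0 by rewrite pnatr_eq0.
have p4 : (4 ^+ n : R) != 0 by rewrite expf_neq0.
have -> : (n.*2.+2%:R : R) = 2 * n.+1%:R by rewrite -doubleS -muln2 natrM mulrC.
by field; rewrite f0 p4 -[1]/(1%:R) -natrD add1n n0.
Qed.

(** By monotonicity the square lies between the products of [wallis n.*2] with its two neighbours,
    which [wallisM] evaluates. *)
Lemma wallis_even_bounds n : (0 < n)%N ->
  pi / 2 / (n.*2.+1)%:R <= wallis n.*2 ^+ 2 <= pi / 2 / (n.*2)%:R.
Proof.
case: n => // n _; rewrite doubleS.
have w m : 0 <= wallis m by rewrite ltW ?wallis_gt0.
apply/andP; split.
- rewrite ler_pdivrMr// -(wallisM n.*2.+2) mulrC ler_pM2r// expr2.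
  by apply: ler_wpM2r => //; exact: wallis_le.
- rewrite ler_pdivlMr// -(wallisM n.*2.+1) [leRHS]mulrC ler_pM2r// expr2.
  by apply: ler_wpM2l => //; exact: wallis_le.
Qed.

End wallis.

Section stirling.
Context {R : realType}.

(* Stirling's formula says that this tends to ln (2 * pi) / 2; the limit is read
   off from 2 stirling_log n - stirling_log (2 n), where only the central
   binomial coefficient survives and Wallis' product applies. *)
Definition stirling_log n : R :=
  ln n`!%:R - (n%:R + 2^-1) * ln n%:R + n%:R.

(** With x = 1 / n the difference is (n + 1/2) ln (1 + x) - 1. The shift by 1/2 cancels the term of
    order x, so two Taylor terms leave a summable error of order x ^ 2. *)
Lemma stirling_log_step n : (0 < n)%N ->
  `|stirling_log n - stirling_log n.+1| <= (n%:R ^+ 2)^-1.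
Proof.
move=> n0; have N0 : 0 < n%:R :> R by rewrite ltr0n.
have F0 : 0 < n`!%:R :> R by rewrite ltr0n fact_gt0.
set x : R := n%:R^-1; have x0 : 0 < x by rewrite invr_gt0.
have xn : n%:R * x = 1 by rewrite mulfV// gt_eqF.
have eS : n.+1%:R = n%:R * (1 + x) by rewrite mulrDr xn mulr1 -natr1.
have lnS : ln n.+1%:R = ln n%:R + ln (1 + x) :> R.
  by rewrite eS lnM// posrE addr_gt0.
have lnF : ln (n.+1)`!%:R = ln n.+1%:R + ln n`!%:R :> R.
  by rewrite factS natrM lnM// posrE.
rewrite /stirling_log lnF lnS -(natr1 n).
have := @ln1p_taylor R 2 x (ltW x0).
rewrite /ln1p_poly !big_ord_recl big_ord0 /= /bump /= !addn0.
rewrite expr0 !expr1 sqrrN !expr1n !mul1r divr1 addr0 mulN1r.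
set L := ln (1 + x); set l := ln n%:R; set f := ln n`!%:R.
move=> /andP[h1 h2].
have x1 : x <= 1 by rewrite invf_le1// ler1n.
have -> : (n%:R ^+ 2)^-1 = x ^+ 2 by rewrite exprVn.
have -> : f - (n%:R + 2^-1) * l + n%:R -
    (l + L + f - (n%:R + 1 + 2^-1) * (l + L) + (n%:R + 1)) =
    (n%:R + 2^-1) * L - 1 by field.
have L' : L = x - x ^+ 2 / 2 + (L - (x - x ^+ 2 / 2)) by ring.
move: h1 h2; set r := L - _ => h1 h2; rewrite (_ : L = x - x ^+ 2 / 2 + r)//.
have -> : (n%:R + 2^-1) * (x - x ^+ 2 / 2 + r) - 1 =
    (n%:R * x - 1) * (1 - x / 2) - x ^+ 2 / 4 + (n%:R * r + r / 2) by field.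
rewrite xn subrr mul0r add0r.
have h3 : n%:R * r <= x ^+ 2 / 3.
  have -> : x ^+ 2 / 3 = n%:R * x * (x ^+ 2 / 3) by rewrite xn mul1r.
  by rewrite -mulrA ler_pM2l// mulrA -exprS.
have h4 : 0 <= n%:R * r by rewrite mulr_ge0// ltW.
have h5 : x ^+ 3 <= x ^+ 2 by rewrite exprS ler_piMl ?sqr_ge0.
have h6 : 0 <= x ^+ 2 by rewrite sqr_ge0.
rewrite ler_norml; lra.
Qed.

Lemma cvg_harmonicM (c : R) : c / n.+1%:R @[n --> \oo] --> 0.
Proof.
rewrite -(mulr0 c); apply: cvgM; first exact: cvg_cst.
exact: cvg_harmonic.
Qed.

Lemma is_cvg_stirling_log : cvgn stirling_log.
Proof.
(* The decrements of [q] dominate 1 / (n + 1) ^ 2. Hence adding [q] makes the sequence nonincreasing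
   and subtracting it makes it nondecreasing, and the second bounds the first from below. *)
pose q n : R := 2 / n.+1%:R.
have stepb n : - (q n - q n.+1) <=
    stirling_log n.+1 - stirling_log n.+2 <= q n - q n.+1.
  rewrite -ler_norml /q; apply: le_trans (stirling_log_step _) _ => //.
  have n1 : 0 < n.+1%:R :> R by rewrite ltr0n.
  have n2 : 0 < n.+2%:R :> R by rewrite ltr0n.
  have n12 : n.+2%:R = n.+1%:R + 1 :> R by rewrite natr1.
  have n1g : 1 <= n.+1%:R :> R by rewrite ler1n.
  have -> : 2 / n.+1%:R - 2 / n.+2%:R = 2 / (n.+1%:R * n.+2%:R) :> R.
    rewrite n12; field; rewrite -!(natrD _ 1%N) !gt_eqF//.
  rewrite ler_pdivlMr ?mulr_gt0// mulrC ler_pdivrMr ?exprn_gt0// n12 expr2.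
  nra.
suff /cvg_ex[l] : cvgn [sequence stirling_log n.+1]_n.
  by rewrite cvg_shiftS => sl; apply/cvg_ex; exists l.
have -> : [sequence stirling_log n.+1]_n =
    (fun n => stirling_log n.+1 + q n) - q.
  by apply/funext => n /=; rewrite /GRing.add/= /GRing.opp/= addrK.
apply: is_cvgB; last by apply/cvg_ex; exists 0; exact: cvg_harmonicM.
have nd : nondecreasing_seq (fun n => stirling_log n.+1 - q n).
  by apply/nondecreasing_seqP => n /=; have /andP[_ sn] := stepb n; lra.
apply: nonincreasing_is_cvgn.
  by apply/nonincreasing_seqP => n /=; have /andP[sn _] := stepb n; lra.
exists (stirling_log 1 - q 0%N) => _ [n _ <-].
apply: (le_trans (nd 0%N n _)) => //=.
have : 0 <= q n by rewrite /q.
lra.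
Qed.

(** The terms n ln n cancel, and the quantity inside the norm equals (ln (pi / 2) - ln (2 n)) / 2 -
    ln (wallis (2 n)). By [wallis_even_bounds] it lies between 0 and (ln (2 n + 1) - ln (2 n)) /
    2. *)
Lemma stirling_log_double n : (0 < n)%N ->
  `|2 * stirling_log n - stirling_log n.*2 - ln (2 * pi) / 2| <= n%:R^-1.
Proof.
move=> n0; have N0 : 0 < n%:R :> R by rewrite ltr0n.
have F0 : 0 < n`!%:R :> R by rewrite ltr0n fact_gt0.
have FF0 : 0 < (n.*2)`!%:R :> R by rewrite ltr0n fact_gt0.
have e2 : n.*2%:R = 2 * n%:R :> R by rewrite -muln2 natrM mulrC.
have p0 : 0 < pi :> R := pi_gt0 R.
have lnW : ln (wallis n.*2) = ln (pi / 2) + ln (n.*2)`!%:R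
    - n%:R * (2 * ln 2) - 2 * ln n`!%:R :> R.
  rewrite wallis_even lnM ?posrE ?divr_gt0// ?mulr_gt0 ?exprn_gt0//.
  move: (ln (pi / 2)) => P.
  rewrite ln_div ?posrE ?mulr_gt0 ?exprn_gt0// lnM ?posrE ?exprn_gt0//.
  have e4 : 4 = 2 ^+ 2 :> R by ring.
  rewrite {1}e4 -exprM 2?lnXn// -(mulr_natl (ln 2)) -(mulr_natl (ln _`!%:R)).
  rewrite natrM; ring.
have lnp : ln (2 * pi) = 2 * ln 2 + ln (pi / 2) :> R.
  rewrite ln_div ?posrE// lnM ?posrE//; ring.
have ln2n : ln n.*2%:R = ln 2 + ln n%:R :> R by rewrite e2 lnM ?posrE.
have w0 : 0 < wallis n.*2 :> R := wallis_gt0 _.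
have /andP[b1 b2] := @wallis_even_bounds R n n0.
have d0 : 0 < n.*2%:R :> R by rewrite e2 mulr_gt0.
have c1 : 2 * ln (wallis n.*2) <= ln (pi / 2) - ln n.*2%:R :> R.
  rewrite mulr_natl -lnXn// -ln_div ?posrE ?divr_gt0//.
  by rewrite ler_ln ?posrE ?exprn_gt0 ?divr_gt0.
have c2 : ln (pi / 2) - ln n.*2.+1%:R <= 2 * ln (wallis n.*2) :> R.
  rewrite mulr_natl -lnXn// -ln_div ?posrE ?divr_gt0//.
  by rewrite ler_ln ?posrE ?exprn_gt0 ?divr_gt0.
have c3 : ln n.*2.+1%:R <= ln n.*2%:R + n.*2%:R^-1 :> R.
  have -> : n.*2.+1%:R = n.*2%:R * (1 + n.*2%:R^-1) :> R.
    by rewrite mulrDr mulr1 mulfV ?natr1// gt_eqF.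
  rewrite lnM ?posrE ?addr_gt0 ?invr_gt0// lerD2l le_ln1Dx//.
  by apply: lt_trans (ltrN10 _) _; rewrite invr_gt0.
have c4 : n.*2%:R^-1 <= n%:R^-1 :> R.
  by rewrite lef_pV2 ?posrE// ler_nat -addnn leq_addl.
have n1 : 0 < n%:R^-1 :> R by rewrite invr_gt0.
rewrite /stirling_log ln2n e2 ler_norml.
move: lnW lnp c1 c2 c3 ln2n.
set W := ln (wallis _); set P := ln (pi / 2); set Q := ln (2 * pi).
set l := ln n%:R; set L := ln n.*2%:R; set l2 := ln 2; set f := ln n`!%:R.
move=> lnW lnp c1 c2 c3 ln2n.
have -> : 2 * (f - (n%:R + 2^-1) * l + n%:R) - (ln (n.*2)`!%:R
    - (2 * n%:R + 2^-1) * (l2 + l) + 2 * n%:R) - Q / 2 =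
   - W - l / 2 + l2 / 2 + P - Q / 2.
  by rewrite lnW; field; lra.
move: c4 c3 n1; set q := n.*2%:R^-1; set r := n%:R^-1 => c4 c3 n1.
apply/andP; split; lra.
Qed.

Lemma cvg_stirling_log : stirling_log n @[n --> \oo] --> (ln (2 * pi) / 2 : R).
Proof.
have /cvg_ex[/= l sl] := is_cvg_stirling_log.
suff <- : l = ln (2 * pi) / 2 by [].
have sl2 : stirling_log n.*2 @[n --> \oo] --> l.
  apply: (cvg_comp _ _ _ sl).
  move=> A [k _ kA]; exists k => // n /= kn; apply: kA => /=.
  by rewrite -addnn (leq_trans kn) ?leq_addl.
have h1 : 2 * stirling_log n - stirling_log n.*2 @[n --> \oo] --> 2 * l - l.
  by apply: cvgB => //; apply: cvgMl_tmp.
have h2 : 2 * stirling_log n - stirling_log n.*2 @[n --> \oo] --> ln (2 * pi) / 2.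
  apply/subr_cvg0/norm_cvg0P; rewrite -cvg_shiftS /=.
  apply: (@squeeze_cvgr _ _ _ _ (cst 0) (fun n => n.+1%:R^-1)).
  - by near=> n; rewrite normr_ge0/= stirling_log_double.
  - exact: cvg_cst.
  - exact: cvg_harmonic.
have := cvg_unique _ h1 h2; rewrite mulr_natl mulr2n addrK; apply.
exact: Rhausdorff.
Unshelve. all: by end_near. Qed.

End stirling.

(** * Expectation of a product of independent factors *)

Section integral_transfer.
Import HBNNSimple.
Context {d1 d2 : measure_display} {T1 : measurableType d1}
  {T2 : measurableType d2} {R : realType}.
Variables (mu : {measure set T1 -> \bar R}) (nu : {measure set T2 -> \bar R}).
Variables (X : T1 -> R) (Y : T2 -> R) (h : T1 -> R) (C : R).
Hypotheses (mX : measurable_fun [set: T1] X) (mY : measurable_fun [set: T2] Y).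
Hypotheses (mh : measurable_fun [set: T1] h) (h0 : forall t, 0 <= h t).
Hypothesis hX : forall B, measurable B ->
  (\int[mu]_t (h t * \1_B (X t))%:E = C%:E * nu (Y @^-1` B))%E.

Let integral_transfer_nnsfun (phi : {nnsfun R >-> R}) :
  (\int[mu]_t (h t * phi (X t))%:E = C%:E * \int[nu]_t (phi (Y t))%:E)%E.
Proof.
have mA r : measurable (phi @^-1` [set r]) by exact: measurable_sfunP.
have mAY r : measurable (Y @^-1` (phi @^-1` [set r])).
  by rewrite -[X in measurable X]setTI; exact: mY.
have m1 r : measurable_fun [set: T1] (fun t => \1_(phi @^-1` [set r]) (X t) : R).
  by apply: measurableT_comp => //; exact: measurable_indic.
have m2 r : measurable_fun [set: T2] (fun t => \1_(phi @^-1` [set r]) (Y t) : R).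
  by apply: measurableT_comp => //; exact: measurable_indic.
have r0 r y : 0 <= r * \1_(phi @^-1` [set r]) y :> R.
  by rewrite -lee_fin EFinM; exact: nnfun_muleindic_ge0.
transitivity (\sum_(r \in range phi)
    \int[mu]_t (h t * (r * \1_(phi @^-1` [set r]) (X t)))%:E)%E.
  rewrite -ge0_integral_fsum//; last 2 first.
  - by move=> r; apply/measurable_EFinP; do 2 apply: measurable_funM => //.
  - by move=> r t _; rewrite lee_fin mulr_ge0.
  apply: eq_integral => t _; rewrite {1}fimfunE EFinM -fsumEFin// ge0_mule_fsumr.
    by apply: eq_fsbigr.
  by move=> r; rewrite lee_fin.
transitivity (C%:E * \sum_(r \in range phi)
    \int[nu]_t (r * \1_(phi @^-1` [set r]) (Y t))%:E)%E; last first.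
  congr (_ * _)%E; rewrite -ge0_integral_fsum//; last 2 first.
  - by move=> r; apply/measurable_EFinP; apply: measurable_funM.
  - by move=> r t _; rewrite lee_fin.
  by apply: eq_integral => t _; rewrite fsumEFin// -fimfunE.
rewrite ge0_mule_fsumr; last first.
  by move=> r; apply: integral_ge0 => t _; rewrite lee_fin.
apply: eq_fsbigr => r; rewrite inE => -[y _ <-].
have y0 : 0 <= phi y by [].
under eq_integral do rewrite mulrCA EFinM.
rewrite ge0_integralZl_EFin//; last 2 first.
- by move=> t _; rewrite lee_fin mulr_ge0.
- by apply/measurable_EFinP; apply: measurable_funM.
rewrite hX//.
under [in RHS]eq_integral do rewrite EFinM.
rewrite ge0_integralZl_EFin//; last by apply/measurable_EFinP.
rewrite muleCA; congr (_ * (_ * _))%E.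
by rewrite -(setIT (Y @^-1` _)) -integral_indic.
Qed.

(** Extension from indicators to nonnegative functions by monotone convergence. It is used with [h]
    a product of other independent factors, and with [h] the exponential density. *)
Lemma integral_transfer (f : R -> R) :
  measurable_fun [set: R] f -> (forall x, 0 <= f x) ->
  (\int[mu]_t (h t * f (X t))%:E = C%:E * \int[nu]_t (f (Y t))%:E)%E.
Proof.
move=> mf f0.
have mEf : measurable_fun [set: R] (EFin \o f) by exact/measurable_EFinP.
pose f_ := nnsfun_approx measurableT mEf.
have f_cvg x : EFin \o f_^~ x @ \oo --> (f x)%:E.
  by apply: cvg_nnsfun_approx => // y _; rewrite lee_fin.
have nd x : {homo f_^~ x : m n / (m <= n)%N >-> m <= n}.
  by move=> m n mn; exact/lefP/nd_nnsfun_approx.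
have mfX n : measurable_fun [set: T1] (fun t => f_ n (X t)).
  exact: measurableT_comp.
have mfY n : measurable_fun [set: T2] (fun t => f_ n (Y t)).
  exact: measurableT_comp.
have -> : (\int[mu]_t (h t * f (X t))%:E =
    limn (fun n => \int[mu]_t (h t * f_ n (X t))%:E))%E.
  rewrite -monotone_convergence//.
  - apply: eq_integral => t _; apply/esym/cvg_lim => //.
    under eq_fun do rewrite EFinM.
    by rewrite EFinM; apply: cvgeZl => //; exact: f_cvg.
  - by move=> n; apply/measurable_EFinP/measurable_funM.
  - by move=> n t _; rewrite lee_fin mulr_ge0.
  - by move=> t _ m n mn; rewrite lee_fin ler_wpM2l// nd.
under eq_fun do rewrite integral_transfer_nnsfun.
apply/cvg_lim => //; apply: cvgeZl => //.
have -> : (\int[nu]_t (f (Y t))%:E = \int[nu]_t limn (fun n => (f_ n (Y t))%:E))%E.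
  by apply: eq_integral => t _; apply/esym/cvg_lim => //; exact: f_cvg.
apply: cvg_monotone_convergence => //.
- by move=> n; apply/measurable_EFinP.
- by move=> n t _; rewrite lee_fin.
- by move=> t _ m n mn; rewrite lee_fin nd.
Qed.

End integral_transfer.

Section independence.
Context {d : measure_display} {T : measurableType d} {R : realType}.
Variables (P : probability T R) (X : nat -> {RV P >-> R}).
Hypothesis indepX : mutually_independent X.

Let measurable_comp_RV (f : R -> R) i : measurable_fun [set: R] f ->
  measurable_fun [set: T] (fun t => f (X i t)).
Proof. by move=> mf; apply: measurableT_comp => //; exact: measurable_funPT. Qed.

(** A product of indicators is the indicator of the intersection, to which independence over the
    indices below [M] applies. *)
Let indicator_prod (B : nat -> set R) M : (forall i, measurable (B i)) ->
  (\int[P]_t (\prod_(i < M) \1_(B i) (X i t))%:E =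
   (\prod_(i < M) fine (P (X i @^-1` B i)))%:E)%E.
Proof.
move=> mB; pose J := [fset i in iota 0 M]%fset.
have mX i : measurable (X i @^-1` B i).
  by rewrite -[X in measurable X]setTI; exact: measurable_funPT.
have big_J (S : Type) (idx : S) (op : Monoid.com_law idx) (F : nat -> S) :
    \big[op/idx]_(i <- J) F i = \big[op/idx]_(i < M) F i.
  rewrite -(big_mkord xpredT) /index_iota subn0; apply: perm_big.
  apply: uniq_perm; rewrite ?fset_uniq ?iota_uniq// => i.
  by rewrite !inE.
have := indepX J mB; rewrite big_J => PJ.
have -> : (\prod_(i < M) fine (P (X i @^-1` B i)))%:E =
    (\prod_(i < M) P (X i @^-1` B i))%E.
  rewrite -prodEFin; apply: eq_bigr => i _.
  by rewrite fineK// fin_num_measure.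
rewrite -PJ -[X in P X]setIT -integral_indic//; last first.
  by apply: fin_bigcap_measurable => // ; exact: finite_fset.
apply: eq_integral => t _; congr (_%:E).
rewrite indicE; case: (boolP (t \in _)) => [|].
  rewrite inE => tB; rewrite big1// => i _; rewrite indicE mem_set//.
  by apply: tB; rewrite /= !inE mem_iota /= ltn_ord.
rewrite notin_setE => /existsNP[i] /not_implyP[]; rewrite /= !inE mem_iota/=.
move=> iM iB; apply/esym; rewrite (bigD1 (Ordinal iM))//=.
by rewrite indicE memNset ?mul0r.
Qed.

(* The indicators are traded for the functions f i one index at a time. *)
Let expectation_prod_indic m M (f : nat -> R -> R) (e : nat -> R) :
  (forall i, measurable_fun [set: R] (f i)) -> (forall i x, 0 <= f i x) ->
  (forall i, \int[P]_t (f i (X i t))%:E = (e i)%:E)%E ->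
  (forall i, (m <= i)%N -> exists2 B, measurable B & f i = \1_B) ->
  (\int[P]_t (\prod_(i < M) f i (X i t))%:E = (\prod_(i < M) e i)%:E)%E.
Proof.
elim: m f e => [|m IH] f e mf f0 ef fB.
  have /choice[B BP] : forall i, exists B, measurable B /\ f i = \1_B.
    by move=> i; have [B mB fiB] := fB i (leq0n i); exists B.
  have -> : f = fun i => \1_(B i) by apply/funext => i; have [] := BP i.
  rewrite indicator_prod => [|i]; last by have [] := BP i.
  congr (_%:E); apply: eq_bigr => i _; have [mBi fi] := BP i.
  have mX : measurable (X i @^-1` B i).
    by rewrite -[X in measurable X]setTI; exact: measurable_funPT.
  apply/EFin_inj; rewrite -ef fi fineK ?fin_num_measure//.
  by rewrite -[X in P X]setIT -integral_indic.
(* Once [f m] is replaced by an indicator, only the functions of index below [m] are arbitrary, so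
   the induction hypothesis applies. *)
pose upd (S : Type) (g : nat -> S) y i := if i == m then y else g i.
have upd_eq S (g : nat -> S) y i : i != m -> upd S g y i = g i.
  by rewrite /upd => /negPf ->.
have IHm B : measurable B -> (\int[P]_t
    (\prod_(i < M) upd _ f \1_B i (X i t))%:E =
    (\prod_(i < M) upd _ e (fine (P (X m @^-1` B))) i)%:E)%E.
  move=> mB; apply: IH.
  - by move=> i; rewrite /upd; case: ifP.
  - by move=> i x; rewrite /upd; case: ifP.
  - move=> i; rewrite /upd; case: ifP => // /eqP ->.
    have mX : measurable (X m @^-1` B).
      by rewrite -[X in measurable X]setTI; exact: measurable_funPT.
    rewrite fineK ?fin_num_measure//.
    by rewrite -[X in P X]setIT -integral_indic.
  - move=> i mi; rewrite /upd; case: ifPn => [_|im]; first by exists B.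
    by apply: fB; rewrite ltn_neqAle eq_sym im.
(* If [m] is outside the product, the replacement at [m] is invisible and any measurable set will
   do. *)
have [mM|Mm] := ltnP m M; last first.
  have := IHm setT measurableT.
  under eq_integral do under eq_bigr do
    rewrite upd_eq ?(ltn_eqF (leq_trans (ltn_ord _) Mm))//.
  by under eq_bigr do rewrite upd_eq ?(ltn_eqF (leq_trans (ltn_ord _) Mm))//.
pose m' := Ordinal mM.
have e0 i : 0 <= e i.
  by rewrite -lee_fin -ef; apply: integral_ge0 => t _; rewrite lee_fin.
have mXm : measurable_fun [set: T] (X m) by exact: measurable_funPT.
(* The weight is the product of the other factors and the constant is the product of their
   expectations; the identity required on indicators is [IHm]. *)
have := @integral_transfer _ _ _ _ _ P P (X m) (X m)
  (fun t => \prod_(i < M | i != m') f i (X i t))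
  (\prod_(i < M | i != m') e i) mXm mXm.
move=> /(_ _ _ _ (f m) (mf m) (f0 m)).
under eq_integral do rewrite mulrC
  -(bigD1 m' (P := xpredT) (F := fun i : 'I_M => f i (X i _)))//.
rewrite ef -EFinM mulrC.
rewrite -(bigD1 m' (P := xpredT) (F := fun i : 'I_M => e i))//; apply.
- under eq_fun do rewrite big_mkcond/=.
  apply: measurable_prod => i _; case: (i != m') => //.
  exact: measurable_comp_RV.
- by move=> t; apply: prodr_ge0.

move=> B mB.
have mXB : measurable (X m @^-1` B).
  by rewrite -[X in measurable X]setTI; exact: measurable_funPT.
transitivity (((\prod_(i < M | i != m') e i) * fine (P (X m @^-1` B)))%:E);
  last by rewrite EFinM fineK ?fin_num_measure.
have upd_prod g y : \prod_(i < M) upd R g y i =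
    (\prod_(i < M | i != m') g i) * y.
  rewrite (bigD1 m')//= {1}/upd eqxx mulrC; congr (_ * _).
  by apply: eq_bigr => i im; rewrite upd_eq.
rewrite -upd_prod -IHm//; apply: eq_integral => t _; congr (_%:E).
rewrite -(upd_prod (fun i => f i (X i t))); apply: eq_bigr => i _.
by rewrite /upd; case: ifP => // /eqP ->.
Qed.

Lemma expectation_prod_independent M (f : nat -> R -> R) (e : nat -> R) :
  (forall i, measurable_fun [set: R] (f i)) -> (forall i x, 0 <= f i x) ->
  (forall i, \int[P]_t (f i (X i t))%:E = (e i)%:E)%E ->
  (\int[P]_t (\prod_(i < M) f i (X i t))%:E = (\prod_(i < M) e i)%:E)%E.
Proof.
move=> mf f0 ef.
(* Beyond [M] the functions are padded with the indicator of the whole line, so that the tail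
   consists of indicators. *)
have := @expectation_prod_indic M M
  (fun i => if (i < M)%N then f i else \1_setT)
  (fun i => if (i < M)%N then e i else 1).
under eq_integral do under eq_bigr do rewrite ltn_ord.
under eq_bigr do rewrite ltn_ord.
apply.
- by move=> i; case: ifP.
- by move=> i x; case: ifP.
- move=> i; case: ifP => // _.
  under eq_integral do rewrite indicE in_setT.
  by rewrite integral_cst// mul1e; exact: probability_setT.
- by move=> i; rewrite leqNgt => /negPf ->; exists setT.
Qed.

End independence.

(** * Mixed Poisson law over a sum of exponentials *)

Section gamma_integral.
Context {R : realType}.
Variable r : R.
Hypothesis r0 : 0 < r.

(** The Poisson weight of k at mean r x, without the factor r ^ k. Dropping that factor lets an
    exponential density be absorbed by a mere change of [r]. *)
Definition monomial_expR k (x : R) := x ^+ k / k`!%:R * expR (- (r * x)).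

(** The primitive that tends to 0 at +oo, obtained by solving the relation of
    [is_derive_monomial_expR] for [monomial_expR k]. *)
Fixpoint monomial_expR_primitive k (x : R) : R :=
  match k with
  | 0 => - (r^-1 * monomial_expR 0 x)
  | k'.+1 => r^-1 * (monomial_expR_primitive k' x - monomial_expR k x)
  end.

Lemma is_derive_monomial_expR k (x : R) : is_derive x 1 (monomial_expR k)
  ((if k is k'.+1 then monomial_expR k' x else 0) - r * monomial_expR k x).
Proof.
have d1 : is_derive x 1 (fun y => expR (- (r * y))) (expR (- (r * x)) * - (r * 1)).
  have dr := is_derive1Ml r (is_derive_id x 1).
  exact: (is_derive1_comp (is_derive_expR _) (is_deriveN dr)).
have d2 : is_derive x 1 (fun y => y ^+ k / k`!%:R)
    (k`!%:R^-1 * (k%:R * x ^+ k.-1 * 1)).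
  under eq_fun do rewrite mulrC.
  exact: (is_derive1Ml _ (is_derive1X k (is_derive_id x 1))).
apply: (is_derive_eq (is_derive1M d2 d1)).
rewrite /monomial_expR; case: k {d2} => [|k] /=.
  by rewrite fact0 expr0 mul0r !mulr1 !(mulr0, mul0r); ring.
have f0 : k`!%:R != 0 :> R by rewrite pnatr_eq0 -lt0n fact_gt0.
have k0 : k.+1%:R != 0 :> R by rewrite pnatr_eq0.
rewrite factS natrM; field; rewrite f0.
by rewrite -[1]/(1%:R) -natrD add1n k0.
Qed.

Lemma is_derive_monomial_expR_primitive k (x : R) :
  is_derive x 1 (monomial_expR_primitive k) (monomial_expR k x).
Proof.
have rn0 : r != 0 by rewrite gt_eqF.
elim: k => [|k IH] /=.
  apply: (is_derive_eq (is_deriveN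
    (is_derive1Ml r^-1 (is_derive_monomial_expR 0 x)))).
  by rewrite sub0r mulrN opprK mulKf.
apply: (is_derive_eq (is_derive1Ml r^-1
  (is_derive1B IH (is_derive_monomial_expR k.+1 x)))).
by rewrite opprB addrCA subrr addr0 mulKf.
Qed.

Lemma cvg_monomial_expR k : monomial_expR k x @[x --> +oo] --> 0.
Proof.
(* The bound comes from exp (r x) >= (r x) ^ (k + 1) / (k + 1)!, one degree more than the
   monomial. *)
apply: (@squeeze_cvgr _ _ _ _ (cst 0) (fun x => (k.+1%:R / r ^+ k.+1) * x^-1)).
- near=> x; have x0 : 0 < x by near: x; exact: nbhs_pinfty_gt.
  have f0 : 0 < k`!%:R :> R by rewrite ltr0n fact_gt0.
  rewrite /monomial_expR; apply/andP; split.
    by rewrite mulr_ge0 ?expR_ge0 ?divr_ge0 ?exprn_ge0 ?ltW.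
  have rx0 : 0 <= r * x by rewrite mulr_ge0 ?ltW.
  have := expR_ge1Dxn k rx0.
  rewrite expRN ler_pdivrMr ?expR_gt0// => e.
  have c0 : 0 <= k.+1%:R / r ^+ k.+1 / x.
    by rewrite !divr_ge0 ?exprn_ge0 ?ltW.
  have : k.+1%:R / r ^+ k.+1 / x * ((r * x) ^+ k.+1 / (k.+1)`!%:R) <=
      k.+1%:R / r ^+ k.+1 / x * expR (r * x).
    by rewrite ler_wpM2l//; apply: le_trans e; rewrite lerDr.
  apply: le_trans; rewrite le_eqVlt; apply/orP; left; apply/eqP.
  have rk0 : r ^+ k != 0 by rewrite expf_neq0// gt_eqF.
  have rn0 : r != 0 by rewrite gt_eqF.
  rewrite factS natrM exprMn !exprS; field.
  by rewrite rk0 rn0 -[1]/(1%:R) -natrD add1n (pnatr_eq0 _ k.+1) !gt_eqF.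
- exact: cvg_cst.
- rewrite -(mulr0 (k.+1%:R / r ^+ k.+1)); apply: cvgM; first exact: cvg_cst.
  apply/gtr0_cvgV0; last exact: cvg_id.
  by near=> x; near: x; exact: nbhs_pinfty_gt.
Unshelve. all: by end_near. Qed.

Lemma cvg_monomial_expR_primitive k :
  monomial_expR_primitive k x @[x --> +oo] --> 0.
Proof.
elim: k => [|k IH] /=.
  rewrite -oppr0 -(mulr0 r^-1); apply: cvgN; apply: cvgM.
    exact: cvg_cst.
  exact: cvg_monomial_expR.
rewrite -(mulr0 r^-1); apply: cvgM; first exact: cvg_cst.
by rewrite -(subr0 0); apply: cvgB => //; exact: (cvg_monomial_expR k.+1).
Qed.

Lemma monomial_expR_primitive0 k :
  monomial_expR_primitive k 0 = - (r ^+ k.+1)^-1.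
Proof.
elim: k => [|k IH] /=; rewrite /monomial_expR.
  by rewrite expr0 fact0 divr1 mulr0 oppr0 expR0 !mulr1.
by rewrite IH expr0n !mul0r subr0 mulrN -invfM -exprS.
Qed.

Lemma continuous_monomial_expR k : continuous (monomial_expR k).
Proof.
move=> x; apply/differentiable_continuous/derivable1_diffP.
by apply: ex_derive; exact: is_derive_monomial_expR.
Qed.

Lemma integral_monomial_expR k :
  (\int[lebesgue_measure]_(x in `[0%R, +oo[) (monomial_expR k x)%:E =
   (r ^- k.+1)%:E)%E.
Proof.
have dF x := is_derive_monomial_expR_primitive k x.
rewrite (@ge0_continuous_FTC2y R (monomial_expR k) (monomial_expR_primitive k) 0 0).
- by rewrite monomial_expR_primitive0 sub0e EFinN oppeK.
- by move=> x x0; rewrite mulr_ge0 ?expR_ge0 ?divr_ge0 ?exprn_ge0.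
- by apply: continuous_subspaceT; exact: continuous_monomial_expR.
- exact: cvg_monomial_expR_primitive.
- by move=> x _; apply: ex_derive.
- apply/cvg_at_right_filter/differentiable_continuous/derivable1_diffP.
  exact: ex_derive.
- by move=> x _; rewrite derive1E; apply: derive_val.
Qed.

End gamma_integral.

Section exponential_sums.
Context {R : realType}.

(** The binomial theorem, in the form that says that Poisson laws convolve; it splits one summand
    off a sum. *)
Lemma monomial_expRD (c : R) n s x : monomial_expR c n (s + x) =
  \sum_(k < n.+1) monomial_expR c k s * monomial_expR c (n - k) x.
Proof.
rewrite /monomial_expR mulrDr opprD expRD addrC exprDn mulr_suml mulr_suml.
apply: eq_bigr => k _; have kn : (k <= n)%N by rewrite -ltnS.
have f0 j : j`!%:R != 0 :> R by rewrite pnatr_eq0 -lt0n fact_gt0.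
rewrite -(bin_fact kn) 2!natrM -mulr_natr; field.
by rewrite !f0 pnatr_eq0 -lt0n bin_gt0.
Qed.

Lemma monomial_expR_0 (c : R) n : monomial_expR c n 0 = (n == 0%N)%:R.
Proof.
by rewrite /monomial_expR mulr0 oppr0 expR0 mulr1; case: n => [|n];
  rewrite ?expr0 ?fact0 ?divr1// expr0n mul0r.
Qed.

(** The hockey-stick identity. With the truncated predecessor it also holds for [m = 0], where only
    the term k = 0 survives. *)
Lemma sum_bin_diag m n :
  (\sum_(k < n.+1) 'C((k + m).-1, k) = 'C(n + m, n))%N.
Proof.
elim: n => [|n IH]; first by rewrite big_ord_recl big_ord0 !bin0.
by rewrite big_ord_recr/= IH addSn binS addnC.
Qed.

Context {d : measure_display} {T : measurableType d} (P : probability T R).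

(** The absolute value makes the integrand nonnegative everywhere, as [integral_transfer] requires,
    and changes nothing where the density is supported. *)
Lemma expectation_monomial_expR (l c : R) k (X : {RV P >-> R}) :
  0 < l -> 0 < c -> exponentially_distributed l X ->
  (\int[P]_t (monomial_expR c k `|X t|)%:E = (l / (l + c) ^+ k.+1)%:E)%E.
Proof.
move=> l0 c0 Xl.
have mE : measurable_fun [set: R] (fun x => monomial_expR c k `|x|).
  apply: measurableT_comp; last exact: normr_measurable.
  by apply: continuous_measurable_fun; exact: continuous_monomial_expR.
have mX : measurable_fun [set: T] X by exact: measurable_funPT.
have pdf0 (x : R) : 0 <= exponential_pdf l x by rewrite exponential_pdf_ge0// ltW.
have E0 (x : R) : 0 <= monomial_expR c k `|x|.
  by rewrite mulr_ge0 ?expR_ge0 ?divr_ge0 ?exprn_ge0.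
have := @integral_transfer _ _ _ _ _ (@lebesgue_measure R) P id X
  (exponential_pdf l) 1 (@measurable_id _ _ setT) mX
  (measurable_exponential_pdf l) pdf0.
move=> /(_ _ (fun x => monomial_expR c k `|x|) mE E0).
rewrite mul1e => <-; last first.
  move=> B mB; rewrite mul1e -[RHS]/(distribution P X B) Xl// /exponential_prob.
  rewrite [RHS]integral_mkcond; apply: eq_integral => x _.
  rewrite patchE indicE; case: ifPn => xB; first by rewrite mulr1.
  by rewrite mulr0.
(* On the half-line the density times the weight of rate [c] is l times the weight of rate [l + c]:
   a gamma integral. *)
have -> : (l / (l + c) ^+ k.+1)%:E = (l%:E *
    \int[lebesgue_measure]_(x in `[0%R, +oo[) (monomial_expR (l + c) k x)%:E)%E.
  by rewrite integral_monomial_expR ?addr_gt0.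
rewrite -ge0_integralZl_EFin//; last 3 first.
- move=> x; rewrite /= in_itv/= andbT => x0.
  by rewrite lee_fin mulr_ge0 ?expR_ge0 ?divr_ge0 ?exprn_ge0.
- apply/measurable_EFinP; apply: measurable_funTS.
  by apply: continuous_measurable_fun; exact: continuous_monomial_expR.
- exact: ltW.
rewrite [RHS]integral_mkcond; apply: eq_integral => x _.
rewrite patchE; case: ifPn => [|].
  rewrite inE/= in_itv/= andbT => x0; rewrite exponential_pdfE//.
  rewrite ger0_norm// /monomial_expR -EFinM; congr (_%:E).
  rewrite mulrDl opprD expRD mulNr; ring.
rewrite notin_setE/= in_itv/= andbT => /negP; rewrite -ltNge => x0.
by rewrite lt0_exponential_pdf// mul0r.
Qed.

Variables (l c : R) (X : nat -> {RV P >-> R}).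
Hypotheses (l0 : 0 < l) (c0 : 0 < c).
Hypothesis indepX : mutually_independent X.
Hypothesis expX : forall i, exponentially_distributed l (X i).

(* Independent factors in the later variables are carried along so that the
   induction can absorb one of them into the sum at each step. *)
Let expectation_monomial_expR_prod m M n (f : nat -> R -> R) (e : nat -> R) :
  (forall i, measurable_fun [set: R] (f i)) -> (forall i x, 0 <= f i x) ->
  (forall i, \int[P]_t (f i (X (m + i)%N t))%:E = (e i)%:E)%E ->
  (\int[P]_t (monomial_expR c n (\sum_(i < m) `|X i t|)
     * \prod_(i < M) f i (X (m + i)%N t))%:E =
   ('C((n + m).-1, n)%:R * (l ^+ m / (l + c) ^+ (n + m))
     * \prod_(i < M) e i)%:E)%E.
Proof.
elim: m M n f e => [|m IH] M n f e mf f0 ef.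
  under eq_integral do rewrite big_ord0 monomial_expR_0.
  case: n => [|n] /=.
    under eq_integral do rewrite mul1r.
    rewrite (expectation_prod_independent indepX M mf f0 ef).
    by rewrite bin0 !expr0 divr1 !mul1r.
  under eq_integral do rewrite mul0r.
  by rewrite integral0 bin_small ?addn0// !mul0r.
have mabs k : measurable_fun [set: R] (fun x => monomial_expR c k `|x|).
  apply: measurableT_comp; last exact: normr_measurable.
  by apply: continuous_measurable_fun; exact: continuous_monomial_expR.
have abs0 k (x : R) : 0 <= x -> 0 <= monomial_expR c k x.
  by move=> x0; rewrite mulr_ge0 ?expR_ge0 ?divr_ge0 ?exprn_ge0.
(* The weight at [X m] becomes the first carried factor, and the given factors move up by one
   index. *)
pose f' k (i : nat) :=
  if i is j.+1 then f j else fun x : R => monomial_expR c (n - k) `|x|.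
pose e' k (i : nat) := if i is j.+1 then e j else l / (l + c) ^+ (n - k).+1.
have mf' k i : measurable_fun [set: R] (f' k i).
  by case: i => [|i]; [exact: mabs|exact: mf].
have f'0 k i (x : R) : 0 <= f' k i x.
  by case: i => [|i]; [exact: abs0|exact: f0].
have ef' k i : (\int[P]_t (f' k i (X (m + i)%N t))%:E = (e' k i)%:E)%E.
  case: i => [|i] /=; first exact: expectation_monomial_expR.
  by rewrite -ef addSnnS.
have mXi i : measurable_fun [set: T] (X i) by exact: measurable_funPT.
transitivity (\sum_(k < n.+1) \int[P]_t
    (monomial_expR c k (\sum_(i < m) `|X i t|)
     * \prod_(i < M.+1) f' k i (X (m + i)%N t))%:E)%E.
  rewrite -ge0_integral_sum//; last 2 first.
  - move=> k; apply/measurable_EFinP; apply: measurable_funM.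
      apply: measurableT_comp.
        by apply: continuous_measurable_fun; exact: continuous_monomial_expR.
      by apply: measurable_sum => i; apply: measurableT_comp.
    by apply: measurable_prod => i _; apply: measurableT_comp.
  - by move=> k t _; rewrite lee_fin mulr_ge0 ?abs0 ?sumr_ge0 ?prodr_ge0.
  apply: eq_integral => t _; rewrite sumEFin; congr (_%:E).
  rewrite big_ord_recr/= monomial_expRD mulr_suml; apply: eq_bigr => k _.
  rewrite big_ord_recl/= addn0 mulrA; congr (_ * _).
  by apply: eq_bigr => i _; rewrite /= addSnnS.
under eq_bigr => k _ do rewrite (IH _ _ _ _ (mf' k) (f'0 k) (ef' k)).
rewrite sumEFin; congr (_%:E).
(* The powers of [l] and [l + c] multiply to the same value for every k, so only the binomial
   coefficients are summed. *)
rewrite addnS/= -sum_bin_diag natr_sum !mulr_suml; apply: eq_bigr => k _.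
rewrite big_ord_recl/= mulrA; congr (_ * _).
have kn : (k <= n)%N by rewrite -ltnS.
rewrite -!mulrA; congr (_ * _).
have lc0 : l + c != 0 by rewrite gt_eqF ?addr_gt0.
have -> : ((n + m).+1 = (k + m) + (n - k).+1)%N.
  by rewrite addnS addnAC subnKC.
by rewrite [l ^+ m.+1]exprSr (exprD _ (k + m)) invfM; ring.
Qed.

Lemma expectation_monomial_expR_sum m n :
  (\int[P]_t (monomial_expR c n (\sum_(i < m) `|X i t|))%:E =
   ('C((n + m).-1, n)%:R * (l ^+ m / (l + c) ^+ (n + m)))%:E)%E.
Proof.
have := @expectation_monomial_expR_prod m 0 n (fun _ => cst 0) (fun _ => 0).
under eq_integral do rewrite big_ord0 mulr1.
rewrite big_ord0 mulr1; apply => //.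
by move=> i; rewrite integral0.
Qed.

End exponential_sums.

Section mixed_poisson_exponential.
Context {R : realType}.

Lemma poisson_prob_set1 (y : R) n : poisson_prob y 0 [set n] =
  (if 0 < y then poisson_pmf y n else (n == 0%N)%:R)%:E.
Proof.
rewrite /poisson_prob; case: ifPn => // _.
  by rewrite esum_set1// lee_fin poisson_pmf_ge0.
rewrite diracE (_ : (0%N \in [set n]) = (n == 0%N))//.
by apply/idP/eqP => [|->]; rewrite inE.
Qed.

(** At s = 0 the Dirac mass agrees with the general formula because 0 ^+ 0 = 1. *)
Lemma poisson_prob_monomial_expR (c s : R) n : 0 < c -> 0 <= s ->
  poisson_prob (c * s) 0 [set n] = (c ^+ n * monomial_expR c n s)%:E.
Proof.
move=> c0; rewrite le_eqVlt => /predU1P[<-|s0]; rewrite poisson_prob_set1.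
  rewrite mulr0 ltxx monomial_expR_0; case: n => [|n] /=.
    by rewrite expr0 mul1r.
  by rewrite mulr0.
by rewrite mulr_gt0// /poisson_pmf mulr_gt0// exprMn /monomial_expR !mulrA.
Qed.

Context {d : measure_display} {T : measurableType d} (P : probability T R).

Lemma exponentially_distributed_ge0 (l : R) (X : {RV P >-> R}) :
  exponentially_distributed l X -> \forall t \ae P, 0 <= X t.
Proof.
move=> Xl; exists (X @^-1` `]-oo, 0[%classic); split.
- by rewrite -[X in measurable X]setTI; apply: measurable_funPT.
- rewrite -[LHS]/(distribution P X `]-oo, 0[%classic) Xl//.
  rewrite /exponential_prob integral0_eq// => x; rewrite /= in_itv/= => x0.
  by rewrite lt0_exponential_pdf.
- by move=> t /= /negP; rewrite -ltNge in_itv/=.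
Qed.

Variables (l : R) (X : nat -> {RV P >-> R}) (Z : {RV P >-> nat}).
Hypothesis l0 : 0 < l.
Hypothesis indepX : mutually_independent X.
Hypothesis expX : forall i, exponentially_distributed l (X i).

Lemma mixed_poisson_sample_mean (N : R) m n : 0 < N -> (0 < m)%N ->
  mixed_poisson (fun t => N * sample_mean X m t) Z ->
  (P (Z @^-1` [set n]) = ('C((n + m).-1, n)%:R *
     (l ^+ m * (N / m%:R) ^+ n / (l + N / m%:R) ^+ (n + m)))%:E)%E.
Proof.
move=> N0 m0 /(_ setT [set n] measurableT); rewrite preimage_setT setTI => ->.
set c := N / m%:R; have c0 : 0 < c by rewrite divr_gt0 ?ltr0n.
have mX i : measurable_fun [set: T] (X i) by exact: measurable_funPT.
have mS : measurable_fun [set: T] (fun t => \sum_(i < m) `|X i t|).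
  by apply: measurable_sum => i; apply: measurableT_comp.
have mmono : measurable_fun [set: T]
    (fun t => monomial_expR c n (\sum_(i < m) `|X i t|)).
  apply: measurableT_comp => //.
  by apply: continuous_measurable_fun; exact: continuous_monomial_expR.
have mono0 t : 0 <= monomial_expR c n (\sum_(i < m) `|X i t|).
  by rewrite mulr_ge0 ?expR_ge0 ?divr_ge0 ?exprn_ge0 ?sumr_ge0.
have cn0 : 0 <= c ^+ n by rewrite exprn_ge0 ?ltW.
(* Both integrands agree almost everywhere: almost surely all [X i] are nonnegative, and N times the
   mean is c times the sum. *)
transitivity (\int[P]_t (c ^+ n * monomial_expR c n (\sum_(i < m) `|X i t|))%:E)%E.
  apply: ge0_ae_eq_integral => //.
  - under eq_fun do rewrite poisson_prob_set1.
    have mY : measurable_fun [set: T] (fun t => N * sample_mean X m t).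
      by do 2 apply: measurable_funM => //; apply: measurable_sum.
    apply/measurable_EFinP; apply: measurable_fun_ifT => //.
      exact: measurable_fun_ltr.
    exact: (measurableT_comp (measurable_poisson_pmf n measurableT)).
  - by apply/measurable_EFinP; apply: measurable_funM.
  - by move=> t _; rewrite lee_fin mulr_ge0.
  have := ae_foralln (fun i => exponentially_distributed_ge0 (expX i)).
  apply: filterS => t X0 _.
  rewrite -poisson_prob_monomial_expR ?sumr_ge0//.
  congr (poisson_prob _ _ _); rewrite /sample_mean /c -mulrA; congr (_ * (_ * _)).
  by apply: eq_bigr => i _; rewrite ger0_norm.
under eq_integral do rewrite EFinM.
rewrite ge0_integralZl_EFin//; last 2 first.
- by move=> t _; rewrite lee_fin.
- exact/measurable_EFinP.
rewrite (expectation_monomial_expR_sum l0 c0 indepX expX) -EFinM.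
by congr (_%:E); ring.
Qed.

End mixed_poisson_exponential.

(** * Asymptotics *)

Section negative_binomial_asymptotics.
Context {R : realType}.
Implicit Types (a l c p q x : R).

(** The function H: the exponential rate counted per exponential variable. *)
Definition log_rate l a c : R :=
  (1 + a * c) * (ln (1 + a * c) - ln (l + c)) - a * c * ln a + ln l.

(** An exact identity. All the error is in the three values of [stirling_log], which share a common
    limit. *)
Lemma ln_negative_binomial l a c m n :
  0 < l -> 0 < a -> 0 < c -> (0 < m)%N -> (0 < n)%N ->
  n%:R = m%:R * (a * c) ->
  0 < 'C((n + m).-1, n)%:R * (l ^+ m * c ^+ n / (l + c) ^+ (n + m)) /\
  ln ('C((n + m).-1, n)%:R * (l ^+ m * c ^+ n / (l + c) ^+ (n + m))) =
  stirling_log (n + m) - stirling_log n - stirling_log m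
  + m%:R * log_rate l a c - (ln n%:R + ln (1 + a * c)) / 2.
Proof.
move=> l0 a0 c0 m0 n0 nE.
have M0 : 0 < m%:R :> R by rewrite ltr0n.
have N0 : 0 < n%:R :> R by rewrite ltr0n.
have NM0 : 0 < (n + m)%:R :> R by rewrite ltr0n addn_gt0 n0.
have f0 k : 0 < k`!%:R :> R by rewrite ltr0n fact_gt0.
(* Passing to the binomial coefficient of n + m costs the factor m / (n + m) = 1 / (1 + a c), which
   flips the sign of the half logarithm of 1 + a c left by Stirling. *)
have binE : 'C((n + m).-1, n)%:R =
    m%:R / (n + m)%:R * ((n + m)`!%:R / (n`!%:R * m`!%:R)) :> R.
  case: m m0 M0 NM0 {nE} => // m _ M0 NM0; rewrite addnS -pred_Sn.
  have := bin_fact (leq_addr m n); rewrite addKn => /(congr1 (fun k => k%:R : R)).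
  move=> bE; rewrite !factS; move: bE; rewrite !natrM => <-.
  have nm0 : (n + m).+1%:R != 0 :> R by rewrite pnatr_eq0.
  have m1 : m.+1%:R != 0 :> R by rewrite pnatr_eq0.
  have fn := lt0r_neq0 (f0 n); have fm := lt0r_neq0 (f0 m).
  move: nm0 m1; move: (_.+1%:R) (m.+1%:R) => A B A0 B0.
  by field; rewrite fn fm A0 B0.
have lc0 : 0 < l + c by rewrite addr_gt0.
have ac0 : 0 < 1 + a * c by rewrite addr_gt0// mulr_gt0.
have lnf k : ln k`!%:R = stirling_log k + (k%:R + 2^-1) * ln k%:R - k%:R :> R.
  by rewrite /stirling_log; ring.
rewrite binE; split.
  by rewrite !(mulr_gt0, invr_gt0, exprn_gt0).
rewrite !(lnM, lnV) ?posrE ?(mulr_gt0, invr_gt0, exprn_gt0)// !lnXn// !lnf.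
have lnN : ln n%:R = ln m%:R + (ln a + ln c) :> R.
  by rewrite nE !lnM ?posrE ?mulr_gt0.
have nmE : (n + m)%:R = m%:R * (1 + a * c) :> R by rewrite natrD nE; ring.
have lnNM : ln (n + m)%:R = ln m%:R + ln (1 + a * c) :> R.
  by rewrite nmE lnM ?posrE.
rewrite -(mulr_natl (ln l)) -(mulr_natl (ln c)) -(mulr_natl (ln (l + c))).
rewrite lnNM lnN /log_rate nmE nE.
move: (ln m%:R) (ln (1 + a * c)) (ln a) (ln c) (ln (l + c)) (ln l) => *.
by field.
Qed.

End negative_binomial_asymptotics.

(** * Taylor expansion common to both regimes *)

Section log_product_taylor.
Context {R : realType}.
Variables p q : R.
Hypotheses (p0 : 0 < p) (q0 : 0 < q).

Definition log_product (x : R) := (1 + p * x) * (ln (1 + p * x) - ln (1 + q * x)).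

(** The coefficient of x ^ (j + 1) in ln (1 + p x) - ln (1 + q x). *)
Let u (j : nat) : R := (-1) ^+ j * ((p ^+ j.+1 - q ^+ j.+1) / j.+1%:R).

(* The coefficient of x ^+ k.+1 in log_product, for k >= 1. *)
Definition log_product_coef (k : nat) : R :=
  (-1) ^+ k * (p * (q ^+ k / k%:R) - q ^+ k.+1 / k.+1%:R
               - p ^+ k.+1 * (k%:R^-1 - k.+1%:R^-1)).

Let coefE k : u k.+1 + p * u k = log_product_coef k.+1.
Proof.
have k1 : k.+1%:R != 0 :> R by rewrite pnatr_eq0.
have k2 : k.+2%:R != 0 :> R by rewrite pnatr_eq0.
rewrite /u /log_product_coef; move: (k.+1%:R) (k.+2%:R) k1 k2 => A B A0 B0.
rewrite !exprS; field; by rewrite A0 B0.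
Qed.

Let ln1p_poly_diff K x :
  ln1p_poly K (p * x) - ln1p_poly K (q * x) = \sum_(j < K) u j * x ^+ j.+1.
Proof.
rewrite /ln1p_poly -sumrB; apply: eq_bigr => j _.
rewrite /u -mulrBr -mulrBl !exprMn -mulrBl -!mulrA.
by congr (_ * (_ * _)); rewrite mulrC.
Qed.

(** After multiplication by 1 + p x, the coefficients up to degree K + 1 are final. The term of
    degree K + 2 still lacks its contribution from [u K.+1] and is left to the remainder. *)
Let mul_poly_diff K x :
  (1 + p * x) * (\sum_(j < K.+1) u j * x ^+ j.+1) =
  (p - q) * x + \sum_(1 <= k < K.+1) log_product_coef k * x ^+ k.+1
  + p * u K * x ^+ K.+2.
Proof.
elim: K => [|K IH].
  rewrite big_ord_recl big_ord0 big_geq// /u expr0 !expr1 divr1; ring.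
rewrite big_ord_recr/= mulrDr IH (big_nat_recr K.+1)//= -coefE !exprS; ring.
Qed.

Lemma log_product_taylor K : exists C : R, forall x : R, 0 < x -> x <= 1 ->
  `|log_product x - ((p - q) * x
     + \sum_(1 <= k < K.+1) log_product_coef k * x ^+ k.+1)| <= C * x ^+ K.+2.
Proof.
(* The first summand pays for the incomplete top term, the second for the two logarithmic
   remainders; 1 + p bounds 1 + p x since x <= 1. *)
exists (p * `|u K| + (1 + p) * (p ^+ K.+2 + q ^+ K.+2)) => x x0 x1.
have px0 : 0 <= p * x by rewrite mulr_ge0 ?ltW.
have qx0 : 0 <= q * x by rewrite mulr_ge0 ?ltW.
have rem (y : R) : 0 <= y -> `|ln (1 + y) - ln1p_poly K.+1 y| <= y ^+ K.+2.
  move=> y0; have /andP[t0 t1] := ln1p_taylor K.+1 y0.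
  move: t1; rewrite -[X in X <= _](ger0_norm t0) normrM normrX normrN1.
  rewrite expr1n mul1r => t1; apply: le_trans t1 _.
  rewrite ler_pdivrMr ?ltr0n// ler_peMr ?exprn_ge0//.
  by rewrite ler1n.
have rp := rem _ px0; have rq := rem _ qx0.
have -> : log_product x - ((p - q) * x
     + \sum_(1 <= k < K.+1) log_product_coef k * x ^+ k.+1) =
  p * u K * x ^+ K.+2 + (1 + p * x) *
   ((ln (1 + p * x) - ln1p_poly K.+1 (p * x)) -
    (ln (1 + q * x) - ln1p_poly K.+1 (q * x))).
  have := mul_poly_diff K x; rewrite -ln1p_poly_diff /log_product.
  move: (ln1p_poly K.+1 (p * x)) (ln1p_poly K.+1 (q * x)) => A B.
  move: (\sum_(1 <= k < K.+1) _) => S.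
  set X := x ^+ K.+2; set U := u K => e.
  have -> : (p - q) * x + S = (1 + p * x) * (A - B) - p * U * X by rewrite e; ring.
  ring.
rewrite [leRHS]mulrDl; apply: le_trans (ler_normD _ _) _; apply: lerD.
  by rewrite 2!normrM (gtr0_norm p0) (ger0_norm (exprn_ge0 _ (ltW x0))).
rewrite normrM -mulrA; apply: ler_pM => //.
  by rewrite ger0_norm ?addr_ge0// lerD2l ler_piMr// ltW.
apply: le_trans (ler_normB _ _) _.
by rewrite [leRHS]mulrDl -!exprMn; apply: lerD.
Qed.

End log_product_taylor.

(** * Limits of powers and equivalence through logarithms *)

Section asymptotic_equivalence.
Context {R : realType}.
Implicit Types (D : set R) (f g : R -> R) (b : R).

Lemma cvg_powRy b : 0 < b -> x `^ b @[x --> +oo] --> +oo.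
Proof.
move=> b0; apply/cvgryPge => A; near=> x.
have x1 : Num.max A 1 `^ b^-1 <= x by near: x; exact: nbhs_pinfty_ge.
apply: (@le_trans _ _ (Num.max A 1)); first by rewrite le_max lexx.
have M0 : 0 <= Num.max A 1 by rewrite le_max ler01 orbT.
rewrite -[leLHS](powRr1 M0) -(mulVf (lt0r_neq0 b0)) powRrM.
by apply: ge0_ler_powR; rewrite ?nnegrE ?powR_ge0 ?(ltW b0).
Unshelve. all: by end_near. Qed.

Lemma cvg_powRN0 b : b < 0 -> x `^ b @[x --> +oo] --> 0.
Proof.
move=> b0; have -> : (fun x => x `^ b) = (fun x => (x `^ (- b))^-1).
  by apply/funext => x; rewrite powRN invrK.
apply/gtr0_cvgV0; last by apply: cvg_powRy; rewrite oppr_gt0.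
by near=> x; rewrite powR_gt0.
Unshelve. all: by end_near. Qed.

Lemma cvg_within_pinfty D f (l : set_system R) :
  f x @[x --> +oo] --> l -> f x @[x --> within D +oo] --> l.
Proof. by apply: cvg_trans; apply: cvg_app; exact: cvg_within. Qed.

Lemma cvg0_le_powR D f (C b : R) : b < 0 ->
  (\forall x \near within D +oo, `|f x| <= C * x `^ b) ->
  f x @[x --> within D +oo] --> 0.
Proof.
move=> b0 fC; apply/norm_cvg0P.
apply: (@squeeze_cvgr _ _ _ _ (cst 0) (fun x => C * x `^ b)).
- by apply: filterS fC => x fx; rewrite normr_ge0.
- exact: cvg_cst.
- rewrite -(mulr0 C); apply: cvgM; first exact: cvg_cst.
  by apply: cvg_within_pinfty; exact: cvg_powRN0.
Qed.

Lemma cvg_ln1p_powR D (k b : R) : 0 < k -> b < 0 ->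
  ln (1 + k * x `^ b) @[x --> within D +oo] --> 0.
Proof.
move=> k0 b0; apply: (@cvg0_le_powR _ _ k b) => //.
apply: nearW => x; have kx0 : 0 <= k * x `^ b by rewrite mulr_ge0 ?powR_ge0 ?ltW.
rewrite ger0_norm; first by rewrite le_ln1Dx// (lt_le_trans _ kx0)// ltrN10.
by rewrite ln_ge0// lerDl.
Qed.

Lemma near_within_pinfty D (Q : R -> Prop) (M : R) :
  (forall x, M < x -> D x -> Q x) -> \forall x \near within D +oo, Q x.
Proof. by move=> MQ; exists M; split; [exact: num_real|]. Qed.

Lemma equiv_along_ln D f g (M : R) :
  (forall x, M < x -> D x -> 0 < f x /\ 0 < g x) ->
  ln (f x) - ln (g x) @[x --> within D +oo] --> 0 ->
  equiv_along D f g.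
Proof.
move=> fg0 fg; rewrite /equiv_along -(@expR0 R).
have := cvg_comp _ _ fg (@continuous_expR R 0).
apply: cvg_trans; apply: near_eq_cvg; apply: (@near_within_pinfty _ _ M).
move=> x Mx Dx; have [fx gx] := fg0 _ Mx Dx.
by rewrite /= expRB !lnK.
Qed.

(** Carries a limit of a sequence over to real N; at natural values [Num.truncn] returns the integer
    itself. *)
Lemma cvg_stirling_log_truncn D f : f x @[x --> within D +oo] --> +oo ->
  stirling_log (Num.truncn (f x)) @[x --> within D +oo] --> (ln (2 * pi) / 2 : R).
Proof.
move=> fy; apply: (cvg_comp _ _ _ cvg_stirling_log).
move=> A [k _ kA]; have /cvgryPge/(_ k%:R) := fy.
apply: filterS => x kx; apply: kA => /=.
by rewrite truncn_ge_nat// (le_trans _ kx).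
Qed.

Lemma powRM_expr x (b c : R) k : 0 < x ->
  x `^ b * (x `^ c) ^+ k = x `^ (b + c * k%:R).
Proof.
move=> x0; rewrite -powR_mulrn ?powR_ge0// -powRrM powRD//.
by rewrite lt0r_neq0// implybT.
Qed.

End asymptotic_equivalence.

(** * The rate function for small and for large c *)

Section log_rate_expansions.
Context {R : realType}.
Variables lambda a : R.
Hypotheses (lambda0 : 0 < lambda) (a0 : 0 < a).

Lemma log_rate_small c : 0 < c ->
  log_rate lambda a c = log_product a lambda^-1 c - a * c * ln (lambda * a).
Proof.
move=> c0; rewrite /log_rate /log_product.
have -> : lambda + c = lambda * (1 + lambda^-1 * c).
  by rewrite mulrDr mulr1 mulVKf ?gt_eqF.
rewrite !lnM ?posrE ?addr_gt0 ?mulr_gt0 ?invr_gt0//; ring.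
Qed.

(** Here x = 1 / c. Factoring 1 / x out of both logarithms cancels their divergence as x tends to
    0. *)
Lemma log_rate_large x : 0 < x ->
  log_rate lambda a x^-1 = a / x * log_product a^-1 lambda x + ln (lambda * a).
Proof.
move=> x0; rewrite /log_rate /log_product.
have x_neq0 : x != 0 by rewrite gt_eqF.
have a_neq0 : a != 0 by rewrite gt_eqF.
have e1 : 1 + a * x^-1 = a * (x^-1 * (1 + a^-1 * x)) by field; rewrite a_neq0.
have e2 : lambda + x^-1 = x^-1 * (1 + lambda * x) by field.
have y1 : 0 < 1 + a^-1 * x by rewrite addr_gt0// mulr_gt0 ?invr_gt0.
have y2 : 0 < 1 + lambda * x by rewrite addr_gt0// mulr_gt0.
rewrite {2}e1 e2 !lnM ?posrE ?mulr_gt0 ?invr_gt0//.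
move: (ln (1 + a^-1 * x)) (ln (1 + lambda * x)) => A B.
move: (ln x^-1) (ln a) (ln lambda) => *.
by field; rewrite a_neq0.
Qed.

Lemma xiE k : xi lambda a k = log_product_coef a lambda^-1 k.
Proof.
by rewrite /xi /log_product_coef !exprVn [lambda ^+ k.+1]exprS invfM; ring.
Qed.

Lemma zetaE k : zeta lambda a k = a * log_product_coef a^-1 lambda k.
Proof.
have a_neq0 : a != 0 by rewrite gt_eqF.
rewrite /zeta /log_product_coef !exprVn [a ^+ k.+1]exprS invfM.
have e : a * a^-1 = 1 by rewrite divff.
rewrite (_ : lambda ^+ k * (k%:R^-1 - a * lambda / k.+1%:R)
    - a ^- k * (k%:R^-1 - k.+1%:R^-1) =
  a * a^-1 * (lambda ^+ k / k%:R) - a * (lambda ^+ k.+1 / k.+1%:R)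
    - a * a^-1 * a ^- k * (k%:R^-1 - k.+1%:R^-1)); first by ring.
by rewrite e exprS; ring.
Qed.

End log_rate_expansions.

(** * The three regimes of alpha *)

Section mixed_poisson_asymptotics.
Context {R : realType} {d : measure_display} {T : measurableType d}.
Variables (P : probability T R) (lambda a alpha : R).
Variables (X : nat -> {RV P >-> R}) (Z : R -> {RV P >-> nat}).
Hypotheses (lambda0 : 0 < lambda) (a0 : 0 < a) (alpha0 : 0 < alpha).
Hypothesis indepX : mutually_independent X.
Hypothesis expX : forall i, exponentially_distributed lambda (X i).
Hypothesis poisZ : forall N, admissible a alpha N ->
  mixed_poisson (fun t => N * sample_mean X (Num.truncn (N `^ alpha)) t) (Z N).

Let ln_p_E (N : R) : 0 < N -> admissible a alpha N -> 0 < p_ Z a N /\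
  ln (p_ Z a N) = stirling_log (Num.truncn (N * a + N `^ alpha))
    - stirling_log (Num.truncn (N * a)) - stirling_log (Num.truncn (N `^ alpha))
    + N `^ alpha * log_rate lambda a (N `^ (1 - alpha))
    - (ln (N * a) + ln (1 + a * N `^ (1 - alpha))) / 2.
Proof.
move=> N0 DN; have := poisZ DN; have [[n n0 nE] [m m0 mE]] := DN.
rewrite mE natrK => mpZ.
have cE : N `^ (1 - alpha) = N / m%:R.
  by rewrite powRB ?(gt_eqF N0) ?implybT// powRr1 ?(ltW N0)// mE.
have c0 : 0 < N / m%:R by rewrite divr_gt0 ?ltr0n.
have -> : p_ Z a N = 'C((n + m).-1, n)%:R *
    (lambda ^+ m * (N / m%:R) ^+ n / (lambda + N / m%:R) ^+ (n + m)).
  rewrite /p_ nE.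
  have -> : [set t | (Z N t)%:R = n%:R :> R] = Z N @^-1` [set n].
    apply/seteqP; split => t /=; last by move=> ->.
    by move/eqP; rewrite eqr_nat => /eqP.
  by rewrite (mixed_poisson_sample_mean lambda0 indepX expX n N0 m0 mpZ).
have nmE : n%:R = m%:R * (a * (N / m%:R)) :> R.
  have m_neq0 : m%:R != 0 :> R by rewrite pnatr_eq0 -lt0n.
  by rewrite -nE; field.
rewrite nE -natrD !natrK cE.
exact: ln_negative_binomial.
Qed.

Let p_gt0 (N : R) : 0 < N -> admissible a alpha N -> 0 < p_ Z a N.
Proof. by move=> N0 /(ln_p_E N0)[]. Qed.

Let cvg_ln_p :
  ln (p_ Z a N) - (N `^ alpha * log_rate lambda a (N `^ (1 - alpha))
    - (ln (N * a) + ln (1 + a * N `^ (1 - alpha))) / 2 - ln (2 * pi) / 2)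
  @[N --> within (admissible a alpha) +oo] --> 0.
Proof.
have cy : N * a @[N --> within (admissible a alpha) +oo] --> +oo.
  apply: cvg_within_pinfty; exact: gt0_cvgMly.
have py : N `^ alpha @[N --> within (admissible a alpha) +oo] --> +oo.
  by apply: cvg_within_pinfty; exact: cvg_powRy.
have sy : N * a + N `^ alpha @[N --> within (admissible a alpha) +oo] --> +oo.
  apply/cvgryPge => A; have /cvgryPge/(_ A) := cy.
  by apply: filterS => N AN; rewrite (le_trans AN)// lerDl powR_ge0.
(* The Stirling terms enter with signs +, -, - and the same limit ln (2 pi) / 2; the added constant
   compensates the total. *)
have := cvgD (cvgB (cvgB (cvg_stirling_log_truncn sy) (cvg_stirling_log_truncn cy))
  (cvg_stirling_log_truncn py)) (cvg_cst (ln (2 * pi) / 2 : R)).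
move=> /(_ _ _ _ _); rewrite subrr sub0r addNr.
apply: cvg_trans; apply: near_eq_cvg.
apply: (@near_within_pinfty _ _ _ 0) => N N0 DN.
by have [_ ->] := ln_p_E N0 DN; rewrite !fctE; ring.
Qed.

(** From here on no probability remains: each regime is a limit of an explicit real function. *)
Let equiv_along_p (g : R -> R) : (forall N, 0 < N -> 0 < g N) ->
  N `^ alpha * log_rate lambda a (N `^ (1 - alpha))
    - (ln (N * a) + ln (1 + a * N `^ (1 - alpha))) / 2 - ln (2 * pi) / 2
    - ln (g N) @[N --> within (admissible a alpha) +oo] --> 0 ->
  equiv_along (admissible a alpha) (p_ Z a) g.
Proof.
move=> g0 gE; apply: (@equiv_along_ln _ _ _ _ 0) => [N N0 DN|].
  by split; [exact: p_gt0|exact: g0].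
have := cvgD cvg_ln_p gE; move=> /(_ _); rewrite addr0; apply: cvg_trans.
by apply: near_eq_cvg; apply: nearW => N /=; rewrite addrA subrK.
Qed.

Lemma equiv_along_alpha_eq1 : alpha = 1 ->
  equiv_along (admissible a alpha) (p_ Z a)
    (fun N =>
       (Num.sqrt (2 * pi))^-1 * (Num.sqrt (N * a * (a + 1)))^-1
       * expR (- N * (a * ln (a * ((1 + lambda) / (1 + a)))
                      + ln (lambda^-1 * ((1 + lambda) / (1 + a)))))).
Proof.
move=> alpha1; have p0 : 0 < pi :> R := pi_gt0 R.
have a1 : 0 < 1 + a by rewrite addr_gt0.
have l1 : 0 < 1 + lambda by rewrite addr_gt0.
have pi2 : 0 < 2 * pi :> R by rewrite mulr_gt0.
apply: equiv_along_p => [N N0|].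
  apply: mulr_gt0; last exact: expR_gt0.
  by apply: mulr_gt0; rewrite invr_gt0 sqrtr_gt0// !mulr_gt0 ?addr_gt0.
(* For c = 1 the difference is identically zero, so the constant 0 works with any negative
   exponent. *)
apply: (@cvg0_le_powR _ _ _ 0 (-1)); first by rewrite ltrN10.
apply: (@near_within_pinfty _ _ _ 0) => N N0 _.
rewrite alpha1 subrr powRr0 powRr1 ?(ltW N0)// mulr1 /log_rate mulr1.
rewrite mul0r normr_le0; apply/eqP.
(* lnM would otherwise unify with the product in the definition of pi. *)
move: (2 * pi) pi2 => w w0.
have lnsqrt (x : R) : 0 < x -> ln (Num.sqrt x) = ln x / 2.
  by move=> x0; rewrite -powR12_sqrt ?ltW// ln_powR mulrC.
have Na0 : 0 < N * a by rewrite mulr_gt0.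
rewrite [a + 1]addrC [lambda + 1]addrC.
rewrite [ln (_ * expR _)]lnM ?posrE ?expR_gt0 ?mulr_gt0 ?invr_gt0
  ?sqrtr_gt0 ?mulr_gt0// expRK.
rewrite [ln (_^-1 * _^-1)]lnM ?posrE ?invr_gt0 ?sqrtr_gt0 ?mulr_gt0//.
rewrite !lnV ?posrE ?sqrtr_gt0 ?mulr_gt0// !lnsqrt ?mulr_gt0//.
rewrite !(lnM, lnV) ?posrE ?mulr_gt0 ?invr_gt0//.
by field.
Qed.

(** The square root comes from ln (N a) and ln (2 pi), while ln (1 + a c) tends to 0. The linear
    Taylor term and - a c ln (lambda a), multiplied by m with m c = N, form xi0 N. *)
Lemma equiv_along_alpha_gt1 : 1 < alpha ->
  equiv_along (admissible a alpha) (p_ Z a)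
    (fun N =>
       (Num.sqrt (2 * pi * a * N))^-1 * expR (xi0 lambda a * N)
       * expR (\sum_(1 <= k < (Num.truncn (alpha - 1)^-1).+1)
                 xi lambda a k * N `^ ((1 - alpha) * k%:R + 1))).
Proof.
move=> alpha1; set K := Num.truncn _; have p0 : 0 < pi :> R := pi_gt0 R.
have pi2 : 0 < 2 * pi :> R by rewrite mulr_gt0.
have li0 : 0 < lambda^-1 by rewrite invr_gt0.
apply: equiv_along_p => [N N0|].
  apply: mulr_gt0; last exact: expR_gt0.
  apply: mulr_gt0; last exact: expR_gt0.
  by rewrite invr_gt0 sqrtr_gt0 !mulr_gt0.
pose c (N : R) := N `^ (1 - alpha).
pose taylor (N : R) := (a - lambda^-1) * c N
  + \sum_(1 <= k < K.+1) log_product_coef a lambda^-1 k * c N ^+ k.+1.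
have rem0 : N `^ alpha * (log_product a lambda^-1 (c N) - taylor N)
    @[N --> within (admissible a alpha) +oo] --> 0.
  have [C HC] := log_product_taylor a0 li0 K.
  (* The exponent of N in m c ^ (K + 2), the order of the first omitted term; it is negative because
     K + 1 > 1 / (alpha - 1). *)
  have b0 : alpha + (1 - alpha) * K.+2%:R < 0.
    have : (alpha - 1)^-1 < K.+1%:R.
      by rewrite truncnS_gt// invr_ge0 subr_ge0 ltW.
    rewrite invf_plt ?posrE ?subr_gt0 ?ltr0n// => k1.
    have : 1 < (alpha - 1) * K.+1%:R.
      by rewrite -ltr_pdivrMr ?ltr0n// mul1r.
    by rewrite -[K.+2%:R]natr1; nra.
  apply: (@cvg0_le_powR _ _ _ C _ b0).
  apply: (@near_within_pinfty _ _ _ 1) => N N1 _.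
  have N0 : 0 < N by apply: lt_trans N1.
  rewrite normrM ger0_norm ?powR_ge0// -powRM_expr// mulrCA.
  rewrite ler_wpM2l ?powR_ge0// HC ?powR_gt0//.
  rewrite -(powRr0 N); apply: ler_powR; first exact: ltW.
  by rewrite subr_le0 ltW.
have ln0 : ln (1 + a * N `^ (1 - alpha))
    @[N --> within (admissible a alpha) +oo] --> 0.
  by apply: cvg_ln1p_powR => //; rewrite subr_lt0.
have : N `^ alpha * (log_product a lambda^-1 (c N) - taylor N)
    - ln (1 + a * N `^ (1 - alpha)) * 2^-1
    @[N --> within (admissible a alpha) +oo] --> (0 - 0 * 2^-1 : R).
  by apply: cvgB => //; apply: cvgMr_tmp.
rewrite mul0r subrr.
apply: cvg_trans; apply: near_eq_cvg.
apply: (@near_within_pinfty _ _ _ 0) => N N0 _ /=.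
rewrite -/(c N).
have mc k : N `^ alpha * c N ^+ k.+1 = N `^ ((1 - alpha) * k%:R + 1).
  rewrite powRM_expr//; congr (_ `^ _); rewrite -natr1; ring.
have mc1 : N `^ alpha * c N = N.
  by have := mc 0%N; rewrite expr1 mulr0 add0r powRr1 ?ltW.
have mS : N `^ alpha * (\sum_(1 <= k < K.+1)
      log_product_coef a lambda^-1 k * c N ^+ k.+1) =
    \sum_(1 <= k < K.+1) xi lambda a k * N `^ ((1 - alpha) * k%:R + 1).
  by rewrite mulr_sumr; apply: eq_bigr => k _; rewrite mulrCA mc xiE.
rewrite -mS log_rate_small ?powR_gt0// /taylor.
have Na0 : 0 < N * a by rewrite mulr_gt0.
rewrite (_ : 2 * pi * a * N = 2 * pi * (N * a)); last by ring.
move: (2 * pi) pi2 => w w0.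
rewrite [ln (_ * expR (N `^ _ * _))]lnM ?posrE ?expR_gt0 ?mulr_gt0 ?expR_gt0
  ?invr_gt0 ?sqrtr_gt0 ?mulr_gt0// expRK.
rewrite [ln (_ * expR _)]lnM ?posrE ?expR_gt0 ?invr_gt0 ?sqrtr_gt0
  ?mulr_gt0// expRK.
rewrite lnV ?posrE ?sqrtr_gt0 ?mulr_gt0//.
rewrite -powR12_sqrt ?mulr_ge0 ?ltW// ln_powR [ln (w * _)]lnM ?posrE//.
rewrite /xi0.
move: mc1.
move: (N `^ alpha) (c N) (ln (1 + _)) (ln w) (ln (N * a)) => m y u v t mc1.
rewrite -mc1.
move: (ln (lambda * a)) (log_product _ _ _) (\sum_(_ <= _ < _) _) => *.
by field; rewrite gt_eqF.
Qed.

(** Here ln (1 + a c) is not negligible: its leading part ln a + (1 - alpha) ln N joins ln (N a) to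
    give N ^ (alpha / 2 - 1) / a. The linear Taylor term and ln (lambda a) form zeta0. *)
Lemma equiv_along_alpha_lt1 : alpha < 1 ->
  equiv_along (admissible a alpha) (p_ Z a)
    (fun N =>
       (Num.sqrt (2 * pi) * a)^-1 * N `^ (alpha / 2 - 1)
       * expR (zeta0 lambda a * N `^ alpha)
       * expR (\sum_(1 <= k < (Num.truncn (alpha / (1 - alpha))).+1)
                 zeta lambda a k * N `^ ((alpha - 1) * k%:R + alpha))).
Proof.
move=> alpha1; set K := Num.truncn _; have p0 : 0 < pi :> R := pi_gt0 R.
have pi2 : 0 < 2 * pi :> R by rewrite mulr_gt0.
have ai0 : 0 < a^-1 by rewrite invr_gt0.
have alpha10 : 0 < 1 - alpha by rewrite subr_gt0.
apply: equiv_along_p => [N N0|].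
  apply: mulr_gt0; last exact: expR_gt0.
  apply: mulr_gt0; last exact: expR_gt0.
  by apply: mulr_gt0; rewrite ?powR_gt0// invr_gt0 mulr_gt0// sqrtr_gt0.
(* This local [c] is the small variable x of [log_rate_large], the inverse of the ratio N / m. *)
pose c (N : R) := N `^ (alpha - 1).
pose taylor (N : R) := (a^-1 - lambda) * c N
  + \sum_(1 <= k < K.+1) log_product_coef a^-1 lambda k * c N ^+ k.+1.
have rem0 : N `^ alpha * (a / c N) * (log_product a^-1 lambda (c N) - taylor N)
    @[N --> within (admissible a alpha) +oo] --> 0.
  have [C HC] := log_product_taylor ai0 lambda0 K.
  (* The prefactor a / x uses up one power of x, so the remainder is of order m x ^ (K + 1); hence
     the cut at alpha / (1 - alpha). *)
  have b0 : alpha + (alpha - 1) * K.+1%:R < 0.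
    have : alpha / (1 - alpha) < K.+1%:R.
      by rewrite truncnS_gt// divr_ge0 ?ltW.
    by rewrite ltr_pdivrMr//; nra.
  apply: (@cvg0_le_powR _ _ _ (a * C) _ b0).
  apply: (@near_within_pinfty _ _ _ 1) => N N1 _.
  have N0 : 0 < N by apply: lt_trans N1.
  have c0 : 0 < c N by rewrite powR_gt0.
  have c_neq0 : c N != 0 by rewrite gt_eqF.
  rewrite normrM ger0_norm ?mulr_ge0 ?invr_ge0 ?powR_ge0 ?(ltW a0)//.
  rewrite -powRM_expr// -/(c N).
  have -> : a * C * (N `^ alpha * c N ^+ K.+1) =
      N `^ alpha * (a / c N) * (C * c N ^+ K.+2).
    by rewrite [c N ^+ K.+2]exprS; field.
  rewrite ler_wpM2l ?mulr_ge0 ?invr_ge0 ?powR_ge0 ?(ltW a0)// HC//.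
  rewrite -(powRr0 N); apply: ler_powR; first exact: ltW.
  by rewrite subr_le0 ltW.
have ln0 : ln (1 + a^-1 * N `^ (alpha - 1))
    @[N --> within (admissible a alpha) +oo] --> 0.
  by apply: cvg_ln1p_powR => //; rewrite subr_lt0.
have : N `^ alpha * (a / c N) * (log_product a^-1 lambda (c N) - taylor N)
    - ln (1 + a^-1 * N `^ (alpha - 1)) * 2^-1
    @[N --> within (admissible a alpha) +oo] --> (0 - 0 * 2^-1 : R).
  by apply: cvgB => //; apply: cvgMr_tmp.
rewrite mul0r subrr.
apply: cvg_trans; apply: near_eq_cvg.
apply: (@near_within_pinfty _ _ _ 0) => N N0 _ /=.
have c0 : 0 < c N by rewrite powR_gt0.
have c_neq0 : c N != 0 by rewrite gt_eqF.
have a_neq0 : a != 0 by rewrite gt_eqF.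
have cV : N `^ (1 - alpha) = (c N)^-1 by rewrite -powRN opprB.
rewrite cV -/(c N).
have mc k : N `^ alpha * c N ^+ k = N `^ ((alpha - 1) * k%:R + alpha).
  by rewrite powRM_expr// addrC.
have mS : N `^ alpha * (a / c N) * (\sum_(1 <= k < K.+1)
      log_product_coef a^-1 lambda k * c N ^+ k.+1) =
    \sum_(1 <= k < K.+1) zeta lambda a k * N `^ ((alpha - 1) * k%:R + alpha).
  rewrite mulr_sumr; apply: eq_bigr => k _; rewrite -mc zetaE// exprS.
  by field.
rewrite -mS log_rate_large// /taylor.
have lnac : ln (1 + a * (c N)^-1) =
    ln a - (alpha - 1) * ln N + ln (1 + a^-1 * c N).
  have -> : 1 + a * (c N)^-1 = a * (c N)^-1 * (1 + a^-1 * c N).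
    by field; rewrite a_neq0 c_neq0.
  have y0 : 0 < 1 + a^-1 * c N by rewrite addr_gt0// mulr_gt0.
  rewrite lnM ?posrE ?mulr_gt0 ?invr_gt0//; congr (_ + _).
  by rewrite lnM ?posrE ?invr_gt0// lnV ?posrE// ln_powR.
move: (2 * pi) pi2 => w w0.
rewrite [ln (_ * expR (N `^ _ * _ * _))]lnM ?posrE ?expR_gt0 ?mulr_gt0
  ?expR_gt0 ?invr_gt0 ?mulr_gt0 ?sqrtr_gt0 ?powR_gt0// expRK.
rewrite [ln (_ * expR _)]lnM ?posrE ?expR_gt0 ?mulr_gt0 ?invr_gt0 ?mulr_gt0
  ?sqrtr_gt0 ?powR_gt0// expRK.
rewrite [ln (_ * _ `^ _)]lnM ?posrE ?invr_gt0 ?mulr_gt0 ?sqrtr_gt0 ?powR_gt0//.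
rewrite lnV ?posrE ?mulr_gt0 ?sqrtr_gt0//.
rewrite [ln (Num.sqrt _ * a)]lnM ?posrE ?sqrtr_gt0// [ln (N * a)]lnM ?posrE//.
rewrite -powR12_sqrt ?ltW// !ln_powR lnac /zeta0.
move: (N `^ alpha) (c N) c_neq0 (ln (1 + _)) (ln w) (ln N) (ln a) => m y y0 u v t s.
move: (ln (lambda * a)) (log_product _ _ _) (\sum_(_ <= _ < _) _) => *.
by field; rewrite y0 a_neq0.
Qed.

End mixed_poisson_asymptotics.

Theorem mainTheorem4 (R : realType) (d : measure_display)
    (T : measurableType d) (P : probability T R)
    (lambda a alpha : R) (X : nat -> {RV P >-> R}) (Z : R -> {RV P >-> nat}) :
  0 < lambda ->
  lambda^-1 < a ->
  0 < alpha ->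
  mutually_independent X ->
  (forall i, exponentially_distributed lambda (X i)) ->
  (forall N, admissible a alpha N ->
     mixed_poisson (fun t => N * sample_mean X (Num.truncn (N `^ alpha)) t)
                   (Z N)) ->
  [/\ 1 < alpha ->
      equiv_along (admissible a alpha) (p_ Z a)
        (fun N =>
           (Num.sqrt (2 * pi * a * N))^-1 * expR (xi0 lambda a * N)
           * expR (\sum_(1 <= k < (Num.truncn (alpha - 1)^-1).+1)
                     xi lambda a k * N `^ ((1 - alpha) * k%:R + 1))),
      alpha < 1 ->
      equiv_along (admissible a alpha) (p_ Z a)
        (fun N =>
           (Num.sqrt (2 * pi) * a)^-1 * N `^ (alpha / 2 - 1)
           * expR (zeta0 lambda a * N `^ alpha)
           * expR (\sum_(1 <= k < (Num.truncn (alpha / (1 - alpha))).+1)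
                     zeta lambda a k * N `^ ((alpha - 1) * k%:R + alpha)))
    & alpha = 1 ->
      equiv_along (admissible a alpha) (p_ Z a)
        (fun N =>
           (Num.sqrt (2 * pi))^-1 * (Num.sqrt (N * a * (a + 1)))^-1
           * expR (- N * (a * ln (a * ((1 + lambda) / (1 + a)))
                          + ln (lambda^-1 * ((1 + lambda) / (1 + a))))))].
Proof.
move=> lambda0 lambda_a alpha0 indepX expX poisZ.
have a0 : 0 < a by apply: lt_trans lambda_a; rewrite invr_gt0.
split.
- exact: equiv_along_alpha_gt1 poisZ.
- exact: equiv_along_alpha_lt1 poisZ.
- exact: equiv_along_alpha_eq1 poisZ.
Qed.
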